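(* Let $\Phi$ be a $\operatorname{Spin}(7)$-structure on a smooth $8$-manifold $M$. The spaces $\Omega^4_1$, $\Omega^4_7$, $\Omega^4_{27}$ and $\Omega^4_{35}$ are all eigenspaces of the operator $\Lambda_\Phi$, with distinct eigenvalues. Specifically (pointwise), $$\Omega^4_1=\{\sigma\in\Omega^4:\Lambda_\Phi(\sigma)=-24\,\sigma\},\qquad \Omega^4_{27}=\{\sigma\in\Omega^4:\Lambda_\Phi(\sigma)=+4\,\sigma\},$$ $$\Omega^4_7=\{\sigma\in\Omega^4:\Lambda_\Phi(\sigma)=-12\,\sigma\},\qquad \Omega^4_{35}=\{\sigma\in\Omega^4:\Lambda_\Phi(\sigma)=0\}.$$ In addition, $$\Omega^4_1=\{D(\lambda g):\lambda\in\mathbb R\},\qquad \Omega^4_7=\{D(A_7): A_7\in\Omega^2_7\},\qquad \Omega^4_{35}=\{D(A_0): A_0\in S^2_0\},$$ where $S^2_0$ is the space of symmetric traceless $2$-tensors. Also $$\Omega^4_+=\{\sigma\in\Omega^4:\ast\sigma=\sigma\}=\Omega^4_1\oplus\Omega^4_7\oplus\Omega^4_{27},\qquad \Omega^4_-=\{\sigma\in\Omega^4:\ast\sigma=-\sigma\}=\Omega^4_{35}$$ is the decomposition into self-dual and anti-self-dual $4$-forms.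
   Context: A $\operatorname{Spin}(7)$-structure on a smooth $8$-manifold $M$ (not necessarily compact) is a smooth $4$-form $\Phi$ such that at each point there is a basis $e^1,\dots,e^8$ of the cotangent space in which $\Phi = -\big(e^{1234}+e^{1256}+e^{1278}+e^{3456}+e^{3478}+e^{5678}+e^{1357}-e^{1368}-e^{1458}-e^{1467}-e^{2358}-e^{2367}-e^{2457}+e^{2468}\big)$, where $e^{ijkl}=e^i\wedge e^j\wedge e^k\wedge e^l$. It determines a Riemannian metric $g=g_\Phi$ and an orientation, for which such a basis is oriented orthonormal; then $\ast\Phi=\Phi$. In local coordinates $\Phi=\frac1{24}\Phi_{ijkl}dx^i\wedge dx^j\wedge dx^k\wedge dx^l$ (and similarly for other forms), repeated indices are summed, and the sign convention is such that $\Phi_{ijkl}\Phi_{abcd}g^{kc}g^{ld}=6g_{ia}g_{jb}-6g_{ib}g_{ja}-4\Phi_{ijab}$. All statements about $\Omega^k$ are understood fibrewise. Under the pointwise stabilizer $\operatorname{Spin}(7)\subset\mathrm{SO}(8)$ of $\Phi$, the $4$-forms decompose orthogonally into irreducible representations $\Omega^4=\Omega^4_1\oplus\Omega^4_7\oplus\Omega^4_{27}\oplus\Omega^4_{35}$, with $\Omega^4_l$ of pointwise dimension $l$. $\Omega^2_7=\{\beta\in\Omega^2: \ast(\Phi\wedge\beta)=-3\beta\}$. For a $2$-tensor $A_{ij}$, $D(A)\in\Omega^4$ is defined by $D(A)_{ijkl} = A_{im} g^{mn} \Phi_{njkl} + A_{jm} g^{mn} \Phi_{inkl}+ A_{km}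 g^{mn} \Phi_{ijnl} + A_{lm} g^{mn} \Phi_{ijkn}$. The operator $\Lambda_\Phi:\Omega^4\to\Omega^4$: for $\sigma\in\Omega^4$ write $(\sigma\cdot\Phi)_{ijkl}=\sigma_{ijmn}g^{mp}g^{nq}\Phi_{pqkl}$; then $(\Lambda_\Phi(\sigma))_{ijkl} = (\sigma\cdot\Phi)_{ijkl} + (\sigma\cdot\Phi)_{iklj} + (\sigma\cdot\Phi)_{iljk} + (\sigma\cdot\Phi)_{jkil} + (\sigma\cdot\Phi)_{jlki} + (\sigma\cdot\Phi)_{klij}$. *)

(* Defs.v *)
From mathcomp Require Import all_boot all_algebra all_fingroup.
From mathcomp Require Import reals.

Set Implicit Arguments.
Unset Strict Implicit.
Unset Printing Implicit Defensive.

Import GRing.Theory.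
Local Open Scope ring_scope.

(* Everything lives on one tangent space T_pM, in coordinates given by an
   arbitrary (not necessarily orthonormal) coordinate coframe dx^1, ..., dx^8.
   Indices run over 'I_8, i.e. 0, ..., 7.  A covariant k-tensor is the family of
   its components; R^o makes this type a vectType, so that \dim and {vspace _}
   apply.  2-tensors that serve as matrices (the metric, the argument of D) are
   kept as 'M[R]_8 and turned into tensors by tensor_of_mx. *)
Notation tensor R k := {ffun k%N.-tuple 'I_8 -> R^o}.

Section Tensors.
Variable R : realType.
Implicit Types (k p q : nat) (E A : 'M[R]_8).

Definition tensor_of_fun4 (f : 'I_8 -> 'I_8 -> 'I_8 -> 'I_8 -> R) : tensor R 4 :=
  [ffun t : 4.-tuple 'I_8 => f t`_0 t`_1 t`_2 t`_3].

Definition tensor_of_mx A : tensor R 2 := [ffun t : 2.-tuple 'I_8 => A t`_0 t`_1].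

Definition comp4 (s : tensor R 4) (i j k l : 'I_8) : R := s [tuple i; j; k; l].

(* k-forms: a form a stands for (1/k!) a_{i1...ik} dx^{i1} /\ ... /\ dx^{ik}. *)
Definition is_form k (a : tensor R k) : Prop :=
  forall (s : 'S_k) (t : k.-tuple 'I_8),
    a [tuple tnth t (s u) | u < k] = (-1) ^+ s * a t.

Definition wedge p q (a : tensor R p) (b : tensor R q) : tensor R (p + q) :=
  [ffun t : (p + q).-tuple 'I_8 =>
    (p`! * q`!)%:R^-1 *
    \sum_(s : 'S_(p + q)) (-1) ^+ s *
       (a [tuple tnth t (s (lshift q u)) | u < p] *
        b [tuple tnth t (s (rshift p v)) | v < q])].

(* A coframe e^1, ..., e^8 is a matrix E with e^a = E_{ai} dx^i.  The components
   of e^{a1} /\ ... /\ e^{ak} are the k x k minors of E. *)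
Definition coframe_wedge k E (a : k.-tuple 'I_8) : tensor R k :=
  [ffun t : k.-tuple 'I_8 => \det (\matrix_(u < k, v < k) E (tnth a u) (tnth t v))].

(* e^{ijkl} with 1-based indices *)
Definition coframe_wedge4 E (i j k l : nat) : tensor R 4 :=
  coframe_wedge E [tuple inord i.-1; inord j.-1; inord k.-1; inord l.-1].

Local Notation e E i j k l := (coframe_wedge4 E i%N j%N k%N l%N).

Definition spin7_form E : tensor R 4 :=
  - (e E 1 2 3 4 + e E 1 2 5 6 + e E 1 2 7 8 + e E 3 4 5 6 + e E 3 4 7 8
     + e E 5 6 7 8 + e E 1 3 5 7 - e E 1 3 6 8 - e E 1 4 5 8 - e E 1 4 6 7
     - e E 2 3 5 8 - e E 2 3 6 7 - e E 2 4 5 7 + e E 2 4 6 8).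

Definition spin7_coframe (Phi : tensor R 4) E : Prop :=
  E \in unitmx /\ Phi = spin7_form E.

(* The metric and the volume form for which E is oriented orthonormal:
   g_{ij} = sum_a E_{ai} E_{aj} and vol = e^1 /\ ... /\ e^8.  They depend only on
   the form Phi to which the coframe E is adapted. *)
Definition metric E : 'M[R]_8 := E^T *m E.
Definition inv_metric E : 'M[R]_8 := invmx (metric E).
Definition volume E : tensor R 8 := coframe_wedge E (ord_tuple 8).

Definition raise k E (a : tensor R k) (t : k.-tuple 'I_8) : R :=
  \sum_(s : k.-tuple 'I_8) (\prod_(u < k) inv_metric E (tnth t u) (tnth s u)) * a s.

Definition form_inner k E (a b : tensor R k) : R :=
  k`!%:R^-1 * \sum_(t : k.-tuple 'I_8) raise E a t * b t.

(* (star a)_{j1...jm} = (1/k!) a^{i1...ik} vol_{i1...ik j1...jm} for k + m = 8;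
   this is the convention b /\ star a = <b, a> vol. *)
Definition hodge k m (km : (k + m = 8)%N) E (a : tensor R k) : tensor R m :=
  [ffun t : m.-tuple 'I_8 =>
    k`!%:R^-1 * \sum_(s : k.-tuple 'I_8)
      raise E a s * volume E (tcast km (cat_tuple s t))].

Definition hodge4 E (a : tensor R 4) : tensor R 4 := hodge (erefl : (4 + 4 = 8)%N) E a.
Definition hodge6 E (a : tensor R 6) : tensor R 2 := hodge (erefl : (6 + 2 = 8)%N) E a.

Definition Omega2_7 (Phi : tensor R 4) E (b : tensor R 2) : Prop :=
  is_form b /\ hodge6 E (wedge Phi b) = - 3%:R *: b.

Definition sym_traceless E A : Prop := A^T = A /\ \tr (inv_metric E *m A) = 0.

Definition Dop (Phi : tensor R 4) E A : tensor R 4 :=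
  let P := comp4 Phi in
  let gi := inv_metric E in
  tensor_of_fun4 (fun i j k l : 'I_8 => \sum_m \sum_n
    (A i m * gi m n * P n j k l + A j m * gi m n * P i n k l
     + A k m * gi m n * P i j n l + A l m * gi m n * P i j k n)).

Definition contract2 (Phi : tensor R 4) E (s : tensor R 4) (i j k l : 'I_8) : R :=
  let gi := inv_metric E in
  \sum_m \sum_n \sum_a \sum_b
    comp4 s i j m n * gi m a * gi n b * comp4 Phi a b k l.

Definition Lambda (Phi : tensor R 4) E (s : tensor R 4) : tensor R 4 :=
  let c := contract2 Phi E s in
  tensor_of_fun4 (fun i j k l : 'I_8 =>
    c i j k l + c i k l j + c i l j k + c j k i l + c j l k i + c k l i j).

(* Pullback of tensors by the endomorphism v^i |-> A_{ij} v^j of T_pM. *)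
Definition pullback k A (a : tensor R k) : tensor R k :=
  [ffun t : k.-tuple 'I_8 =>
    \sum_(s : k.-tuple 'I_8) (\prod_(u < k) A (tnth s u) (tnth t u)) * a s].

Definition in_SO8 E A : Prop := A^T *m metric E *m A = metric E /\ \det A = 1.

Definition in_Spin7 (Phi : tensor R 4) E A : Prop :=
  in_SO8 E A /\ pullback A Phi = Phi.

(* Spin7 is a group, so invariance under the right action by pullback is the
   same as invariance under the associated left action A |-> pullback A^-1. *)
Definition spin7_invariant (Phi : tensor R 4) E (W : {vspace tensor R 4}) : Prop :=
  forall A, in_Spin7 Phi E A -> forall s, s \in W -> pullback A s \in W.

Definition spin7_irreducible (Phi : tensor R 4) E (W : {vspace tensor R 4}) : Prop :=
  [/\ W != 0%VS, spin7_invariant Phi E W &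
      forall U : {vspace tensor R 4},
        (U <= W)%VS -> spin7_invariant Phi E U -> U = 0%VS \/ U = W].

Definition orthogonal4 E (V W : {vspace tensor R 4}) : Prop :=
  forall s t, s \in V -> t \in W -> form_inner E s t = 0.

Record spin7_decomposition (Phi : tensor R 4) E
    (O1 O7 O27 O35 : {vspace tensor R 4}) : Prop := Spin7Decomposition {
  decomp_sum : forall s, s \in (O1 + O7 + O27 + O35)%VS <-> is_form s;
  decomp_direct : directv (O1 + O7 + O27 + O35)%VS;
  decomp_orthogonal1 :
    [/\ orthogonal4 E O1 O7, orthogonal4 E O1 O27 & orthogonal4 E O1 O35];
  decomp_orthogonal2 :
    [/\ orthogonal4 E O7 O27, orthogonal4 E O7 O35 & orthogonal4 E O27 O35];
  decomp_irreducible : [/\ spin7_irreducible Phi E O1, spin7_irreducible Phi E O7,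
    spin7_irreducible Phi E O27 & spin7_irreducible Phi E O35];
  decomp_dim :
    [/\ \dim O1 = 1%N, \dim O7 = 7%N, \dim O27 = 27%N & \dim O35 = 35%N]
}.

End Tensors.

(* Main.v *)
(* In an adapted orthonormal frame let beta_b = e^{0b} - *(Phi /\ e^{0b}),
   b = 1, ..., 7; these 2-forms span Omega^2_7.  The forms Phi, D(beta_1), ...,
   D(beta_7) are self-dual and pairwise orthogonal, of square norms 14 and 128, and
     8 Lambda(sigma) = 16 (sigma + *sigma) - 16 <Phi, sigma> Phi
                       - sum_b <D(beta_b), sigma> D(beta_b)
   for every 4-form sigma.  Such identities between integer linear combinations of
   components are decided by computation in the standard frame and carried to an
   arbitrary adapted frame by naturality.  They give the eigenspaces: the span of
   Phi (-24), the span of the D(beta_b) (-12), the self-dual forms orthogonal to both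
   (4, dimension at most 35 - 8 = 27) and the anti-self-dual forms (0).

   The projections onto the eigenspaces commute with Spin(7), so on an irreducible
   summand each one vanishes or is injective.  Comparing dimensions, O35 can only
   consist of anti-self-dual forms; then O27, O7 and O1 are identified in this order
   by orthogonality to the summands already known and by dimension. *)

(* The field [R] is an abstract [realType], so nothing can be evaluated in it. The identities to be
   decided are linear in an unknown tensor and have integer coefficients; a component is therefore
   represented by a formal sum of weighted index lists, the lists are brought to a normal form by
   the symmetry of the tensor, and a boolean computation on integers sees whether everything
   cancels. Dimensions of eigenspaces are only bounded from above: the decomposition is given
   together with its dimensions, and these turn the inclusions of its summands into equalities. The
   order of identification is forced, because irreducibility can only exclude targets of smaller
   dimension: the summand of dimension 35 comes first since the other three targets are smaller, and
   for each later summand the larger targets have to be excluded by orthogonality to what is already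
   known. *)
From HB Require Import structures.
Require Import Defs.
From mathcomp Require Import all_boot all_algebra all_fingroup.
From mathcomp Require Import reals.
From mathcomp Require Import ring.
Import GRing.Theory Num.Theory.
Set Implicit Arguments.
Unset Strict Implicit.
Unset Printing Implicit Defensive.
Local Open Scope ring_scope.

(** * Tensors as functions of index sequences *)

Section SeqTensors.
Variable R : realType.
Implicit Types (f g : seq 'I_8 -> R) (l s t : seq 'I_8) (A B : 'M[R]_8).

(** Components are read at plain lists so that slots can be split off and concatenated freely. The
    default [ord0] pads short lists; a value is meaningful only when the list has length [k]. *)
Definition ev k (a : tensor R k) l : R := a [tuple nth ord0 l u | u < k].

Lemma ev_tuple k (a : tensor R k) (t : k.-tuple 'I_8) : ev a t = a t.
Proof.
by congr (a _); apply: eq_from_tnth => u; rewrite tnth_mktuple -tnth_nth.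
Qed.

Lemma tensor_eq k (a b : tensor R k) :
  (forall l, size l = k -> ev a l = ev b l) -> a = b.
Proof.
by move=> eq_ab; apply/ffunP=> t; rewrite -!ev_tuple eq_ab ?size_tuple.
Qed.

Fixpoint ssum k f : R :=
  if k is k'.+1 then \sum_i ssum k' (fun s => f (i :: s)) else f [::].

Lemma eq_ssum k f g :
  (forall s, size s = k -> f s = g s) -> ssum k f = ssum k g.
Proof.
elim: k f g => [|k IHk] f g eq_fg /=; first exact: eq_fg.
by apply: eq_bigr => i _; apply: IHk => s sz; rewrite eq_fg //= sz.
Qed.

Lemma ssum_tuple k f : \sum_(t : k.-tuple 'I_8) f t = ssum k f.
Proof.
elim: k f => [|k IHk] f /=.
  by rewrite (big_pred1 [tuple]) // => t; rewrite [t]tuple0; apply/esym/eqP.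
under [RHS]eq_bigr => i _ do rewrite -IHk.
rewrite pair_bigA /=.
rewrite (reindex (fun p : 'I_8 * k.-tuple 'I_8 => [tuple of p.1 :: p.2])) /=.
  by apply: eq_bigr.
exists (fun t : k.+1.-tuple 'I_8 => (thead t, [tuple of behead t])) => [[i t] _|t _] /=.
  by rewrite theadE; congr (_, _); apply: val_inj.
by rewrite -tuple_eta.
Qed.

Lemma ssum_sum (J : finType) k (F : J -> seq 'I_8 -> R) :
  ssum k (fun s => \sum_j F j s) = \sum_j ssum k (F j).
Proof.
elim: k F => [|k IHk] F //=.
by rewrite exchange_big /=; apply: eq_bigr => i _; rewrite -IHk.
Qed.

Lemma ssumZ k c f : ssum k (fun s => c * f s) = c * ssum k f.
Proof.
elim: k f => [|k IHk] f //=.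
by rewrite mulr_sumr; apply: eq_bigr => i _; rewrite -IHk.
Qed.

Lemma ssumD k f g : ssum k (fun s => f s + g s) = ssum k f + ssum k g.
Proof.
elim: k f g => [|k IHk] f g //=.
by rewrite -big_split /=; apply: eq_bigr => i _; rewrite -IHk.
Qed.

Lemma ssum_cat m n f :
  ssum (m + n) f = ssum m (fun s => ssum n (fun t => f (s ++ t))).
Proof. by elim: m f => [|m IHm] f //=; apply: eq_bigr => i _; rewrite IHm. Qed.

Lemma ssum_ssum m n (F : seq 'I_8 -> seq 'I_8 -> R) :
  ssum m (fun s => ssum n (F s)) = ssum n (fun t => ssum m (F^~ t)).
Proof.
elim: m F => [|m IHm] F //=.
by rewrite ssum_sum; apply: eq_bigr => i _; rewrite IHm.
Qed.

(* Recursion on the slots makes pullback and contraction amenable to induction,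
   with no casts between tuple types. *)
Fixpoint pbl A f l : R :=
  if l is i :: l' then \sum_j A j i * pbl A (fun s => f (j :: s)) l' else f [::].

Lemma eq_pbl A f g l :
  (forall s, size s = size l -> f s = g s) -> pbl A f l = pbl A g l.
Proof.
elim: l f g => [|i l IHl] f g eq_fg /=; first exact: eq_fg.
by apply: eq_bigr => j _; congr (_ * _); apply: IHl => s sz; rewrite eq_fg //= sz.
Qed.

Lemma pbl_cat A f l1 l2 :
  pbl A f (l1 ++ l2) = pbl A (fun s => pbl A (fun t => f (s ++ t)) l2) l1.
Proof.
by elim: l1 f => [|i l IHl] f //=; apply: eq_bigr => j _; rewrite IHl.
Qed.

Lemma pblZ A c f l : pbl A (fun s => c * f s) l = c * pbl A f l.
Proof.
elim: l f => [|i l IHl] f //=; rewrite mulr_sumr; apply: eq_bigr => j _.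
by rewrite IHl mulrCA.
Qed.

Lemma pblD A f g l : pbl A (fun s => f s + g s) l = pbl A f l + pbl A g l.
Proof.
elim: l f g => [|i l IHl] f g //=; rewrite -big_split; apply: eq_bigr => j _ /=.
by rewrite IHl mulrDr.
Qed.

Lemma pbl_sum (J : finType) A (F : J -> seq 'I_8 -> R) l :
  pbl A (fun s => \sum_j F j s) l = \sum_j pbl A (F j) l.
Proof.
elim: l F => [|i l IHl] F //=; rewrite exchange_big /=; apply: eq_bigr => j _.
by rewrite IHl mulr_sumr.
Qed.

Lemma pbl_comp A B f l : pbl B (pbl A f) l = pbl (A *m B) f l.
Proof.
elim: l f => [|i l IHl] f //=.
under eq_bigr => j _ do rewrite pbl_sum mulr_sumr.
rewrite exchange_big /=; apply: eq_bigr => m _.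
rewrite mxE mulr_suml; apply: eq_bigr => j _.
by rewrite pblZ IHl mulrA [B j i * _]mulrC.
Qed.

Lemma pbl1 f l : pbl 1%:M f l = f l.
Proof.
elim: l f => [|i l IHl] f //=.
rewrite (bigD1 i) //= big1 ?addr0 => [|j /negbTE ne_ji].
  by rewrite mxE eqxx mul1r IHl.
by rewrite mxE ne_ji mul0r.
Qed.

Lemma pbl_pbl A B (F : seq 'I_8 -> seq 'I_8 -> R) l1 l2 :
  pbl A (fun s => pbl B (F s) l2) l1 = pbl B (fun t => pbl A (F^~ t) l1) l2.
Proof.
elim: l1 F => [|i l IHl] F //=.
rewrite pbl_sum; apply: eq_bigr => j _.
by rewrite pblZ IHl.
Qed.

Lemma pbl_ssum k A (F : seq 'I_8 -> seq 'I_8 -> R) l :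
  pbl A (fun s => ssum k (F s)) l = ssum k (fun t => pbl A (F^~ t) l).
Proof.
elim: k F => [|k IHk] F //=.
by rewrite pbl_sum; apply: eq_bigr => j _; rewrite IHk.
Qed.

Definition dot k f g : R := ssum k (fun s => f s * g s).

(** The matrix in each slot crosses to the other factor as its transpose, after an exchange of two
    sums. *)
Lemma dot_pbl k A f g : dot k (pbl A f) g = dot k f (pbl A^T g).
Proof.
rewrite /dot; elim: k f g => [|k IHk] f g //=.
transitivity (\sum_i \sum_j A j i *
    ssum k (fun s => f (j :: s) * pbl A^T (fun t => g (i :: t)) s)).
  apply: eq_bigr => i _; rewrite -(eq_bigr _ (fun j _ => erefl)) /=.
  under eq_ssum => s _ do rewrite mulr_suml.
  rewrite ssum_sum; apply: eq_bigr => j _.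
  by rewrite -IHk -ssumZ; apply: eq_ssum => s _; rewrite mulrA.
rewrite exchange_big /=; apply: eq_bigr => j _.
under [RHS]eq_ssum => s _ do rewrite mulr_sumr.
rewrite ssum_sum; apply: eq_bigr => i _.
by rewrite -ssumZ; apply: eq_ssum => s _; rewrite mxE mulrCA.
Qed.

(* [h] contracts the last [k] slots of [f] with the first [k] slots of [g]. *)
Definition contraction h k f g s t : R :=
  dot k (pbl h (fun u => f (s ++ u))) (fun u => g (u ++ t)).

(** In the contracted slots the pullback of [f] puts [A] to the left of [h], and that of [g] crosses
    over as [A^T] on the right. The result [A *m h *m A^T] is the transformation law of an inverse
    metric, which makes every metric contraction natural. *)
Lemma contraction_pbl A h k f g s t :
  contraction h k (pbl A f) (pbl A g) s t =
  pbl A (fun s' => pbl A (fun t' => contraction (A *m h *m A^T) k f g s' t') t) s.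
Proof.
rewrite /contraction.
transitivity (dot k
   (fun u => pbl A (fun s' => pbl h (fun v => pbl A (fun w => f (s' ++ w)) v) u) s)
   (fun u => pbl A (fun t' => pbl A (fun w => g (w ++ t')) u) t)).
  apply: eq_ssum => u _; congr (_ * _).
    by rewrite -pbl_pbl; apply: eq_pbl => v _; rewrite pbl_cat.
  by rewrite pbl_cat pbl_pbl.
transitivity (ssum k (fun u => pbl A (fun s' => pbl A (fun t' =>
   pbl (A *m h) (fun w => f (s' ++ w)) u * pbl A (fun w => g (w ++ t')) u) t) s)).
  apply: eq_ssum => u _; rewrite mulrC -pblZ; apply: eq_pbl => s' _.
  by rewrite mulrC -pblZ pbl_comp; apply: eq_pbl.
rewrite -pbl_ssum; apply: eq_pbl => s' _; rewrite -pbl_ssum; apply: eq_pbl => t' _.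
transitivity (dot k (pbl (A *m h) (fun w => f (s' ++ w))) (pbl A (fun w => g (w ++ t')))) => //.
rewrite -[A in pbl A (fun w => g _)]trmxK -dot_pbl.
by apply: eq_ssum => u _; rewrite pbl_comp.
Qed.

Lemma pullback_sum A k (l : k.-tuple 'I_8) f :
  \sum_(s : k.-tuple 'I_8) (\prod_(u < k) A (tnth s u) (tnth l u)) * f s = pbl A f l.
Proof.
elim: k l f => [|k IHk] l f.
  rewrite (big_pred1 [tuple]) => [|t]; last by rewrite [t]tuple0; apply/esym/eqP.
  by rewrite big_ord0 mul1r [l]tuple0.
rewrite (reindex (fun p : 'I_8 * k.-tuple 'I_8 => [tuple of p.1 :: p.2])) /=; last first.
  exists (fun t : k.+1.-tuple 'I_8 => (thead t, [tuple of behead t])) => [[i t] _|t _] /=.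
    by rewrite theadE; congr (_, _); apply: val_inj.
  by rewrite -tuple_eta.
case/tupleP: l => i l /=.
rewrite -(pair_bigA _ (fun j (s : k.-tuple 'I_8) => (\prod_(u < k.+1) A (tnth [tuple of j :: s] u)
   (tnth [tuple of i :: l] u)) * f (j :: s))) /=.
apply: eq_bigr => j _; rewrite -IHk mulr_sumr; apply: eq_bigr => s _.
rewrite big_ord_recl !tnth0 mulrA; congr (_ * _ * _).
by apply: eq_bigr => u _; rewrite !tnthS.
Qed.

Lemma ev_pullback k A (a : tensor R k) l :
  size l = k -> ev (pullback A a) l = pbl A (ev a) l.
Proof.
move=> sz_l; pose t := tcast sz_l (in_tuple l).
have -> : l = t by rewrite val_tcast.
rewrite ev_tuple ffunE -pullback_sum.
by apply: eq_bigr => s _; rewrite ev_tuple.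
Qed.

Lemma ev_raise k (E : 'M[R]_8) (a : tensor R k) (t : k.-tuple 'I_8) :
  raise E a t = pbl (inv_metric E)^T (ev a) t.
Proof.
rewrite /raise -pullback_sum; apply: eq_bigr => s _; rewrite ev_tuple.
by congr (_ * _); apply: eq_bigr => u _; rewrite mxE.
Qed.

Lemma pullback_comp k A B (a : tensor R k) :
  pullback B (pullback A a) = pullback (A *m B) a.
Proof.
apply: tensor_eq => l sz_l; rewrite !ev_pullback // -pbl_comp.
by apply: eq_pbl => s sz_s; rewrite ev_pullback // sz_s.
Qed.

Lemma pullback1 k (a : tensor R k) : pullback 1%:M a = a.
Proof. by apply: tensor_eq => l sz_l; rewrite ev_pullback // pbl1. Qed.

Lemma pullbackD k A (a b : tensor R k) :
  pullback A (a + b) = pullback A a + pullback A b.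
Proof.
apply/ffunP => t; rewrite !ffunE -big_split; apply: eq_bigr => s _ /=.
by rewrite ffunE mulrDr.
Qed.

Lemma pullbackZ k A c (a : tensor R k) :
  pullback A (c *: a) = c *: pullback A a.
Proof.
apply/ffunP => t; rewrite !ffunE /= scaler_sumr; apply: eq_bigr => s _ /=.
by rewrite ffunE mulrCA.
Qed.

Lemma form_pullback k A (a : tensor R k) : is_form a -> is_form (pullback A a).
Proof.
move=> form_a s t; rewrite !ffunE mulr_sumr.
rewrite (reindex (fun r : k.-tuple 'I_8 => [tuple tnth r (s u) | u < k])) /=; last first.
  exists (fun r : k.-tuple 'I_8 => [tuple tnth r (s^-1%g u) | u < k]) => r _;
  by apply: eq_from_tnth => u; rewrite !tnth_mktuple ?permKV ?permK.
apply: eq_bigr => r _; rewrite form_a mulrCA; congr (_ * (_ * _)).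
by rewrite [RHS](reindex_perm s) /=; apply: eq_bigr => u _; rewrite !tnth_mktuple.
Qed.

(** The determinant is multilinear in the columns: expanding every entry of [E *m A] and
    distributing gives one term per choice [r] of a summation index for each column, and these
    choices are the slots summed over in the pullback. *)
Lemma coframe_wedgeM k (E A : 'M[R]_8) (a : k.-tuple 'I_8) :
  coframe_wedge (E *m A) a = pullback A (coframe_wedge E a).
Proof.
apply/ffunP => t; rewrite !ffunE -det_tr [LHS]/(\det _) /=.
transitivity (\sum_(s : 'S_k) \sum_(r : {ffun 'I_k -> 'I_8})
  (\prod_u A (r u) (tnth t u)) * ((-1) ^+ s * \prod_u E (tnth a (s u)) (r u))).
  apply: eq_bigr => s _.
  rewrite (eq_bigr (fun u => \sum_m E (tnth a (s u)) m * A m (tnth t u))); last first.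
    by move=> u _; rewrite !mxE.
  rewrite bigA_distr_bigA mulr_sumr; apply: eq_bigr => r _.
  by rewrite big_split /= mulrA mulrC.
rewrite exchange_big /=.
rewrite (reindex (fun r : k.-tuple 'I_8 => [ffun u => tnth r u])) /=; last first.
  exists (fun r : {ffun 'I_k -> 'I_8} => [tuple r u | u < k]) => r _.
    by apply: eq_from_tnth => u; rewrite tnth_mktuple ffunE.
  by apply/ffunP => u; rewrite ffunE tnth_mktuple.
apply: eq_bigr => r _; rewrite -mulr_sumr ffunE.
congr (_ * _); first by apply: eq_bigr => u _; rewrite ffunE.
rewrite -det_tr; apply: eq_bigr => s _; congr (_ * _).
by apply: eq_bigr => u _; rewrite !mxE ffunE.
Qed.

Lemma form_coframe_wedge k (E : 'M[R]_8) (a : k.-tuple 'I_8) :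
  is_form (coframe_wedge E a).
Proof.
move=> s t; rewrite !ffunE.
rewrite (_ : \matrix_(u, v) _ =
  col_perm s (\matrix_(u < k, v < k) E (tnth a u) (tnth t v))); last first.
  by apply/matrixP => u v; rewrite !mxE tnth_mktuple.
by rewrite col_permE det_mulmx det_perm mulrC odd_permV.
Qed.

End SeqTensors.

(** * Antisymmetry through swaps of neighbours *)

Section Alternation.
Variable R : realType.
Implicit Types (f : seq 'I_8 -> R).

(** This form of antisymmetry suits induction on lists and the insertion sort below, whose steps are
    swaps of neighbours. The length is fixed because [ev] pads or truncates other lists. *)
Definition alternating k f := forall l1 x y l2,
  size (l1 ++ x :: y :: l2) = k ->
  f (l1 ++ x :: y :: l2) = - f (l1 ++ y :: x :: l2).

(** Carry [x] past the head of [m], exchange the pair across the rest by induction, and carry [y]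
    back: three changes of sign. *)
Lemma alternating_swap k f l1 x m y l2 : alternating k f ->
  size (l1 ++ x :: m ++ y :: l2) = k ->
  f (l1 ++ x :: m ++ y :: l2) = - f (l1 ++ y :: m ++ x :: l2).
Proof.
move=> alt_f; elim: m l1 => [|z m IHm] l1 /= sz; first exact: alt_f.
rewrite alt_f // -cat_rcons IHm; last first.
  by rewrite -sz !size_cat size_rcons /= !size_cat /= !addnS addSn.
by rewrite cat_rcons opprK alt_f // -sz !size_cat /= !size_cat.
Qed.

(** Translates the exchange of two entries of a list into the transposition of their positions, so
    that it can be matched with [tperm]. *)
Lemma nth_swap (T : eqType) (x0 : T) l1 x m y l2 i j :
  (i < size (l1 ++ x :: m ++ y :: l2))%N ->
  i = (if j == size l1 then (size l1 + size m).+1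
       else if j == (size l1 + size m).+1 then size l1 else j) ->
  nth x0 (l1 ++ x :: m ++ y :: l2) i = nth x0 (l1 ++ y :: m ++ x :: l2) j.
Proof.
have nthE a b n : nth x0 (l1 ++ a :: m ++ b :: l2) n =
    if (n < size l1)%N then nth x0 l1 n else if n == size l1 then a
    else if (n < (size l1 + size m).+1)%N then nth x0 m (n - (size l1).+1)
    else if n == (size l1 + size m).+1 then b
    else nth x0 l2 (n - (size l1 + size m).+2).
  rewrite nth_cat; case: ltngtP => [//|lt_n|->]; last by rewrite subnn.
  rewrite -[(n - _)%N]prednK ?subn_gt0 //= -subnS nth_cat.
  rewrite -(ltn_add2l (size l1).+1) subnKC // addSn.
  case: ltngtP => [//|lt_n'|->]; last by rewrite subSS addKn subnn.
  rewrite -[(_ - _ - _)%N]prednK /=; last by rewrite -subnDA subn_gt0 addSn.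
  by rewrite -subnS -subnDA addnS addSn.
move=> _ ->; rewrite !nthE.
have lt_lm : (size l1 < (size l1 + size m).+1)%N by rewrite ltnS leq_addr.
have nlt_lm : ((size l1 + size m).+1 < size l1)%N = false by rewrite ltnNge ltnW.
have ne_lm : ((size l1 + size m).+1 == size l1) = false by rewrite gtn_eqF.
case: (eqVneq j (size l1)) => [->|/negbTE ne1].
  by rewrite !(ltnn, eqxx, nlt_lm, ne_lm).
case: (eqVneq j (size l1 + size m).+1) => [->|/negbTE ne2].
  by rewrite !(ltnn, eqxx, nlt_lm, ne_lm, lt_lm).
by rewrite ne1 ne2.
Qed.

Lemma alternating_tperm k f (i j : 'I_k) (t : k.-tuple 'I_8) :
  alternating k f -> (i < j)%N ->
  f [tuple tnth t (tperm i j u) | u < k] = - f t.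
Proof.
move=> alt_f lt_ij.
have [l1 [x [m [y [l2 [tE sz1 sz2]]]]]] : exists l1 x m y l2,
    [/\ t = l1 ++ x :: m ++ y :: l2 :> seq _, size l1 = i & size m = (j - i.+1)%N].
  exists (take i t), (tnth t i), (take (j - i.+1) (drop i.+1 t)), (tnth t j).
  exists (drop j.+1 t); split.
  - rewrite -{1}(cat_take_drop i t); congr (_ ++ _).
    rewrite (drop_nth (tnth t i)) ?size_tuple // -tnth_nth; congr (_ :: _).
    rewrite -{1}(cat_take_drop (j - i.+1) (drop i.+1 t)) drop_drop subnK //.
    congr (_ ++ _).
    by rewrite (drop_nth (tnth t i)) ?size_tuple // -tnth_nth.
  - by rewrite size_take size_tuple ltn_ord.
  - rewrite size_take size_drop size_tuple; case: ltnP => // le_k.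
    apply/eqP; rewrite eqn_leq le_k /= leq_sub2r //; exact: ltnW.
have sz : size (l1 ++ x :: m ++ y :: l2) = k by rewrite -tE size_tuple.
have jE : nat_of_ord j = (size l1 + size m).+1.
  by rewrite sz1 sz2 -addSn subnKC.
rewrite tE (alternating_swap alt_f) // opprK; congr f.
apply: (@eq_from_nth _ ord0) => [|u]; rewrite size_tuple.
  by rewrite -sz !size_cat /= !size_cat.
move=> lt_u; have [v ->] : exists v : 'I_k, u = v by exists (Ordinal lt_u).
rewrite nth_mktuple (tnth_nth ord0) tE.
apply: nth_swap; rewrite ?sz ?ltn_ord // -jE sz1.
case: tpermP => [->|->|/eqP ne1 /eqP ne2] /=; rewrite ?eqxx //.
  by rewrite gtn_eqF.
by move: ne1 ne2; rewrite -!val_eqE /= => /negbTE-> /negbTE->.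
Qed.

(** One direction is a transposition of neighbouring positions; the other factors a permutation into
    transpositions and applies [alternating_tperm] to each. *)
Lemma form_alternating k (a : tensor R k) : is_form a <-> alternating k (ev a).
Proof.
split=> [form_a l1 x y l2 sz | alt_a s].
  have lt1 : (size l1 < k)%N by rewrite -sz size_cat /= addnS ltnS leq_addr.
  have lt2 : ((size l1).+1 < k)%N by rewrite -sz size_cat /= !addnS !ltnS leq_addr.
  pose i := Ordinal lt1; pose j := Ordinal lt2.
  have sz' : size (l1 ++ y :: x :: l2) = k by rewrite -sz !size_cat.
  pose t := tcast sz' (in_tuple (l1 ++ y :: x :: l2)).
  have tE : t = l1 ++ y :: x :: l2 :> seq _ by rewrite val_tcast.
  rewrite -tE ev_tuple.
  have /= := form_a (tperm i j) t; rewrite odd_tperm neq_ltn /= ltnSn expr1.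
  rewrite mulN1r => <-; rewrite -ev_tuple; congr (ev a _).
  apply: (@eq_from_nth _ ord0) => [|u]; rewrite ?size_tuple ?sz //.
  move=> lt_u; have [v ->] : exists v : 'I_k, u = v by exists (Ordinal lt_u).
  rewrite nth_mktuple (tnth_nth ord0) tE.
  apply: (@nth_swap _ _ _ _ [::]); rewrite ?sz /= ?addn0 //.
  case: tpermP => [->|->|/eqP ne1 /eqP ne2] /=; rewrite ?eqxx //.
    by rewrite gtn_eqF.
  by move: ne1 ne2; rewrite -!val_eqE /= => /negbTE-> /negbTE->.
case: (prod_tpermP s) => ts -> neq_ts t.
elim: ts neq_ts t => [_ t|[i j] ts IHts /= /andP[ne_ij neq_ts] t].
  rewrite big_nil odd_perm1 expr0 mul1r; congr (a _).
  by apply: eq_from_tnth => u; rewrite tnth_mktuple perm1.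
rewrite big_cons odd_permM odd_tperm ne_ij signr_addb expr1 mulN1r /=.
set t' := [tuple tnth t ((\prod_(t <- ts) tperm t.1 t.2)%g u) | u < k].
transitivity (a [tuple tnth t' (tperm i j u) | u < k]).
  by congr (a _); apply: eq_from_tnth => u; rewrite !tnth_mktuple permM.
transitivity (- a t'); last by rewrite mulNr -(IHts neq_ts t).
rewrite -!ev_tuple; case: (ltngtP i j) => [lt_ij|lt_ji|/val_inj eq_ij].
- exact: alternating_tperm.
- by rewrite tpermC; exact: alternating_tperm.
- by rewrite eq_ij eqxx in ne_ij.
Qed.

End Alternation.

(** * Naturality under pullback *)

Section Naturality.
Variable R : realType.
Implicit Types (E A h : 'M[R]_8).

Lemma metricM E A : metric (E *m A) = A^T *m metric E *m A.
Proof. by rewrite /metric trmx_mul !mulmxA. Qed.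

Lemma metric_unit E : E \in unitmx -> metric E \in unitmx.
Proof. by move=> uE; rewrite unitmx_mul unitmx_tr uE. Qed.

Lemma inv_metric_sym E : (inv_metric E)^T = inv_metric E.
Proof. by rewrite /inv_metric trmx_inv /metric trmx_mul trmxK. Qed.

(** The left side has the shape that [contraction_pbl] produces, so a contraction with the metric of
    [E *m A] becomes one with the metric of [E]. *)
Lemma inv_metricM E A : E \in unitmx -> A \in unitmx ->
  A *m inv_metric (E *m A) *m A^T = inv_metric E.
Proof.
move=> uE uA; have uEA : E *m A \in unitmx by rewrite unitmx_mul uE.
have := mulmxV (metric_unit uEA); rewrite -/(inv_metric _) {1}metricM -!mulmxA.
move=> /mulmx1C; rewrite -!mulmxA => gK.
by rewrite -[LHS](mulKmx (metric_unit uE)) !mulmxA -!mulmxA gK mulmx1.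
Qed.

Lemma metric1 : metric 1%:M = 1%:M :> 'M[R]_8.
Proof. by rewrite /metric trmx1 mulmx1. Qed.

Lemma inv_metric1 : inv_metric 1%:M = 1%:M :> 'M[R]_8.
Proof. by rewrite /inv_metric metric1 invmx1. Qed.

Lemma volumeM E A : volume (E *m A) = pullback A (volume E).
Proof. exact: coframe_wedgeM. Qed.

(** In this form a change of frame of determinant one visibly fixes the volume form. *)
Lemma volume_det E : volume E = \det E *: volume 1%:M.
Proof.
apply/ffunP => t; rewrite !ffunE.
transitivity (\det (E *m \matrix_(u, v)
    (1%:M : 'M[R]_8) (tnth (ord_tuple 8) u) (tnth t v))); last by rewrite det_mulmx.
congr (\det _); apply/matrixP => u v; rewrite !mxE (bigD1 (tnth t v)) //= big1.
  by rewrite !mxE !tnth_ord_tuple eqxx mulr1 addr0.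
by move=> i /negbTE ne_i; rewrite !mxE tnth_ord_tuple ne_i mulr0.
Qed.

Lemma spin7_formM E A : spin7_form (E *m A) = pullback A (spin7_form E).
Proof.
have pullbackN (a : tensor R 4) : pullback A (- a) = - pullback A a.
  by rewrite -scaleN1r pullbackZ scaleN1r.
by rewrite /spin7_form !(pullbackD, pullbackN) /coframe_wedge4 !coframe_wedgeM.
Qed.

Lemma is_formD k (a b : tensor R k) : is_form a -> is_form b -> is_form (a + b).
Proof. by move=> fa fb s t; rewrite !ffunE fa fb mulrDr. Qed.

Lemma is_formZ k c (a : tensor R k) : is_form a -> is_form (c *: a).
Proof. by move=> fa s t; rewrite !ffunE fa; exact: mulrCA. Qed.

Lemma is_formN k (a : tensor R k) : is_form a -> is_form (- a).
Proof. by rewrite -scaleN1r; exact: is_formZ. Qed.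

Lemma form_spin7 E : is_form (spin7_form E).
Proof.
rewrite /spin7_form; apply: is_formN.
by do !(exact: form_coframe_wedge || (apply: is_formD;
  last by [exact: form_coframe_wedge | apply: is_formN; exact: form_coframe_wedge])).
Qed.

Lemma form_inner_contraction E k (a b : tensor R k) :
  form_inner E a b =
  k`!%:R^-1 * contraction (inv_metric E)^T k (ev a) (ev b) [::] [::].
Proof.
congr (_ * _); rewrite /contraction /dot -ssum_tuple.
by apply: eq_bigr => t _; rewrite ev_raise cats0 ev_tuple.
Qed.

Lemma eq_contraction h k f f' g g' (s t : seq 'I_8) :
    (forall u, size u = k -> f (s ++ u) = f' (s ++ u)) ->
    (forall u, size u = k -> g (u ++ t) = g' (u ++ t)) ->
  contraction h k f g s t = contraction h k f' g' s t :> R.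
Proof.
move=> eq_f eq_g; apply: eq_ssum => u sz_u; rewrite eq_g //; congr (_ * _).
by apply: eq_pbl => v; rewrite sz_u => /eq_f.
Qed.

Lemma contraction_pullback E A k p q (a : tensor R p) (b : tensor R q) s t :
    E \in unitmx -> A \in unitmx -> p = (size s + k)%N -> q = (k + size t)%N ->
  contraction (inv_metric (E *m A)) k (ev (pullback A a)) (ev (pullback A b)) s t =
  pbl A (fun s' => pbl A (fun t' =>
    contraction (inv_metric E) k (ev a) (ev b) s' t') t) s.
Proof.
move=> uE uA pE qE.
rewrite -(inv_metricM uE uA) -contraction_pbl.
by apply: eq_contraction => u sz_u; rewrite ev_pullback // size_cat sz_u.
Qed.

Lemma form_inner_pullback E A k (a b : tensor R k) :
    E \in unitmx -> A \in unitmx ->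
  form_inner (E *m A) (pullback A a) (pullback A b) = form_inner E a b.
Proof.
move=> uE uA; rewrite !form_inner_contraction !inv_metric_sym.
by rewrite contraction_pullback ?addn0.
Qed.

Lemma ev_hodge k m (km : (k + m = 8)%N) E (a : tensor R k) l : size l = m ->
  ev (hodge km E a) l =
  k`!%:R^-1 * contraction (inv_metric E)^T k (ev a) (ev (volume E)) [::] l.
Proof.
move=> sz_l; pose t := tcast sz_l (in_tuple l).
have -> : l = t by rewrite val_tcast.
rewrite ev_tuple ffunE; congr (_ * _); rewrite /contraction /dot -ssum_tuple.
apply: eq_bigr => s _; rewrite ev_raise; congr (_ * _).
by rewrite -ev_tuple val_tcast.
Qed.

Lemma hodge_pullback k m (km : (k + m = 8)%N) E A (a : tensor R k) :
    E \in unitmx -> A \in unitmx ->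
  hodge km (E *m A) (pullback A a) = pullback A (hodge km E a).
Proof.
move=> uE uA; apply: tensor_eq => l sz_l; rewrite ev_pullback // ev_hodge //.
rewrite inv_metric_sym volumeM contraction_pullback ?sz_l ?addn0 //=.
rewrite -pblZ; apply: eq_pbl => s sz_s; rewrite ev_hodge ?sz_s //.
by rewrite inv_metric_sym.
Qed.

(** Pullback of a four-index array before it is packed as a tensor. [Lambda] and [Dop] use such
    arrays with permuted arguments, and on nested sums a swap of neighbouring slots is an exchange
    of sums. *)
Definition quad A (G : 'I_8 -> 'I_8 -> 'I_8 -> 'I_8 -> R) i j k l : R :=
  \sum_p A p i * \sum_q A q j * \sum_r A r k * \sum_s A s l * G p q r s.


Lemma quad_swap12 A G i j k l :
  quad A (fun p q r s => G q p r s) i j k l = quad A G j i k l.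
Proof.
rewrite /quad; under eq_bigr => p _ do rewrite mulr_sumr.
rewrite exchange_big /=; apply: eq_bigr => q _; rewrite mulr_sumr.
by apply: eq_bigr => p _; rewrite mulrCA.
Qed.

Lemma quad_swap23 A G i j k l :
  quad A (fun p q r s => G p r q s) i j k l = quad A G i k j l.
Proof.
apply: eq_bigr => p _; congr (_ * _).
under eq_bigr => q _ do rewrite mulr_sumr.
rewrite exchange_big /=; apply: eq_bigr => q _; rewrite mulr_sumr.
by apply: eq_bigr => r _; rewrite mulrCA.
Qed.

Lemma quad_swap34 A G i j k l :
  quad A (fun p q r s => G p q s r) i j k l = quad A G i j l k.
Proof.
apply: eq_bigr => p _; congr (_ * _); apply: eq_bigr => q _; congr (_ * _).
under eq_bigr => r _ do rewrite mulr_sumr.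
rewrite exchange_big /=; apply: eq_bigr => s _; rewrite mulr_sumr.
by apply: eq_bigr => r _; rewrite mulrCA.
Qed.

(** Here and below, the permutations that occur in [Lambda] and [Dop] are composed from the three
    swaps of neighbours above. *)
Lemma quad_iklj A G i j k l :
  quad A (fun i j k l => G i k l j) i j k l = quad A G i k l j.
Proof.
exact: (etrans (quad_swap23 A (fun i j k l => G i j l k) i j k l) (quad_swap34 A G i k j l)).
Qed.

Lemma quad_iljk A G i j k l :
  quad A (fun i j k l => G i l j k) i j k l = quad A G i l j k.
Proof.
exact: (etrans (quad_swap34 A (fun i j k l => G i k j l) i j k l) (quad_swap23 A G i j l k)).
Qed.

Lemma quad_jkil A G i j k l :
  quad A (fun i j k l => G j k i l) i j k l = quad A G j k i l.
Proof.
exact: (etrans (quad_swap12 A (fun i j k l => G i k j l) i j k l) (quad_swap23 A G j i k l)).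
Qed.

Lemma quad_jlki A G i j k l :
  quad A (fun i j k l => G j l k i) i j k l = quad A G j l k i.
Proof.
exact: (etrans (quad_swap12 A (fun i j k l => G i l k j) i j k l)
  (etrans (quad_swap34 A (fun i j k l => G i k l j) j i k l)
  (quad_iklj A G j i l k))).
Qed.

Lemma quad_klij A G i j k l :
  quad A (fun i j k l => G k l i j) i j k l = quad A G k l i j.
Proof.
exact: (etrans (quad_swap23 A (fun i j k l => G j l i k) i j k l)
  (etrans (quad_swap12 A (fun i j k l => G i l j k) i k j l)
  (quad_iljk A G k i j l))).
Qed.

Lemma quad_kijl A G i j k l :
  quad A (fun i j k l => G k i j l) i j k l = quad A G k i j l.
Proof.
exact: (etrans (quad_swap23 A (fun i j k l => G j i k l) i j k l) (quad_swap12 A G i k j l)).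
Qed.

Lemma quad_lijk A G i j k l :
  quad A (fun i j k l => G l i j k) i j k l = quad A G l i j k.
Proof.
exact: (etrans (quad_swap34 A (fun i j k l => G k i j l) i j k l) (quad_kijl A G i j l k)).
Qed.

Lemma quadD A G G' i j k l :
  quad A (fun p q r s => G p q r s + G' p q r s) i j k l =
  quad A G i j k l + quad A G' i j k l.
Proof.
rewrite /quad -big_split; apply: eq_bigr => p _ /=; rewrite -mulrDr -big_split.
congr (_ * _); apply: eq_bigr => q _ /=; rewrite -mulrDr -big_split; congr (_ * _).
apply: eq_bigr => r _ /=; rewrite -mulrDr -big_split; congr (_ * _).
by apply: eq_bigr => s _ /=; rewrite mulrDr.
Qed.

Lemma quadN A G i j k l :
  quad A (fun p q r s => - G p q r s) i j k l = - quad A G i j k l.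
Proof.
rewrite /quad -sumrN; apply: eq_bigr => p _ /=; rewrite -mulrN -sumrN.
congr (_ * _); apply: eq_bigr => q _ /=; rewrite -mulrN -sumrN; congr (_ * _).
apply: eq_bigr => r _ /=; rewrite -mulrN -sumrN; congr (_ * _).
by apply: eq_bigr => s _ /=; rewrite mulrN.
Qed.

Lemma comp4E (a : tensor R 4) i j k l : comp4 a i j k l = ev a [:: i; j; k; l].
Proof. by rewrite -[in RHS]/(tval [tuple i; j; k; l]) ev_tuple. Qed.

Lemma ev_fun4 (G : 'I_8 -> 'I_8 -> 'I_8 -> 'I_8 -> R) i j k l :
  ev (tensor_of_fun4 G) [:: i; j; k; l] = G i j k l.
Proof. by rewrite -[X in ev _ X]/(tval [tuple i; j; k; l]) ev_tuple ffunE. Qed.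

Lemma tensor4_eq (a b : tensor R 4) :
  (forall i j k l, ev a [:: i; j; k; l] = ev b [:: i; j; k; l]) -> a = b.
Proof.
by move=> eq_ab; apply: tensor_eq => -[|i [|j [|k [|l [|? ?]]]]] // _.
Qed.

Lemma pullback_fun4 A G G' :
    (forall i j k l, G' i j k l = quad A G i j k l) ->
  tensor_of_fun4 G' = pullback A (tensor_of_fun4 G).
Proof.
move=> eq_G; apply: tensor4_eq => i j k l; rewrite ev_fun4 ev_pullback // eq_G.
apply: eq_bigr => p _; congr (_ * _); apply: eq_bigr => q _; congr (_ * _).
apply: eq_bigr => r _; congr (_ * _); apply: eq_bigr => s _; congr (_ * _).
exact: esym (ev_fun4 _ _ _ _ _).
Qed.

Lemma sum4_exchange (F : 'I_8 -> 'I_8 -> 'I_8 -> 'I_8 -> R) :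
  \sum_m \sum_n \sum_a \sum_b F m n a b = \sum_a \sum_b \sum_m \sum_n F m n a b.
Proof.
under eq_bigr => m _ do rewrite exchange_big.
rewrite exchange_big; apply: eq_bigr => a _ /=.
under eq_bigr => m _ do rewrite exchange_big.
exact: exchange_big.
Qed.

Lemma contract2_contraction (Phi : tensor R 4) E (s : tensor R 4) i j k l :
  contract2 Phi E s i j k l =
  contraction (inv_metric E) 2 (ev s) (ev Phi) [:: i; j] [:: k; l].
Proof.
rewrite /contract2 sum4_exchange; apply: eq_bigr => a _; apply: eq_bigr => b _ /=.
rewrite mulr_suml; apply: eq_bigr => m _; rewrite mulr_sumr mulr_suml.
by apply: eq_bigr => n _; rewrite !comp4E; ring.
Qed.

Lemma contract2_pullback Phi E A s i j k l : E \in unitmx -> A \in unitmx ->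
  contract2 (pullback A Phi) (E *m A) (pullback A s) i j k l =
  quad A (contract2 Phi E s) i j k l.
Proof.
move=> uE uA; rewrite contract2_contraction.
rewrite contraction_pullback //=.
apply: eq_bigr => p _; congr (_ * _); apply: eq_bigr => q _; congr (_ * _).
apply: eq_bigr => r _; congr (_ * _); apply: eq_bigr => t _; congr (_ * _).
by rewrite contract2_contraction.
Qed.

Lemma Lambda_pullback Phi E A s : E \in unitmx -> A \in unitmx ->
  Lambda (pullback A Phi) (E *m A) (pullback A s) = pullback A (Lambda Phi E s).
Proof.
move=> uE uA; apply: pullback_fun4 => i j k l; rewrite !contract2_pullback //.
set c := contract2 Phi E s; rewrite !quadD (quad_iklj A c) (quad_iljk A c).
by rewrite (quad_jkil A c) (quad_jlki A c) (quad_klij A c).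
Qed.

Definition contract1 (Phi : tensor R 4) E (M : 'M[R]_8) i j k l : R :=
  contraction (inv_metric E) 1 (ev (tensor_of_mx M)) (ev Phi) [:: i] [:: j; k; l].

Lemma ev_mx (M : 'M[R]_8) i j : ev (tensor_of_mx M) [:: i; j] = M i j.
Proof. by rewrite -[X in ev _ X]/(tval [tuple i; j]) ev_tuple ffunE. Qed.

Lemma form4_swaps (a : tensor R 4) : is_form a -> forall i j k l,
  [/\ ev a [:: i; j; k; l] = - ev a [:: j; i; k; l],
      ev a [:: i; j; k; l] = - ev a [:: i; k; j; l]
    & ev a [:: i; j; k; l] = - ev a [:: i; j; l; k]].
Proof.
move=> /form_alternating alt_a i j k l; split.
- exact: (alt_a [::]).
- exact: (alt_a [:: i]).
- exact: (alt_a [:: i; j]).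
Qed.

Lemma form4_of_swaps (a : tensor R 4) :
  (forall i j k l,
    [/\ ev a [:: i; j; k; l] = - ev a [:: j; i; k; l],
        ev a [:: i; j; k; l] = - ev a [:: i; k; j; l]
      & ev a [:: i; j; k; l] = - ev a [:: i; j; l; k]]) -> is_form a.
Proof.
move=> swap; apply/form_alternating.
case=> [|i [|j [|k l]]] x y l2 //=.
- by case: l2 => [|z [|w [|? ?]]] // _; case: (swap x y z w).
- by case: l2 => [|z [|? ?]] // _; case: (swap i x y z).
- by case: l2 => [|? ?] // _; case: (swap i j x y).
- by rewrite size_cat /= !addnS.
Qed.

(** Antisymmetry of [Phi] moves the contracted index to the front, at the cost of one sign per slot
    crossed; all four terms of D become the same contraction with reordered arguments, for which
    naturality is known. *)
Lemma Dop_contract1 Phi E M : is_form Phi ->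
  let c := contract1 Phi E M in
  Dop Phi E M = tensor_of_fun4 (fun i j k l =>
    c i j k l - c j i k l + c k i j l - c l i j k).
Proof.
move=> form_Phi c; apply: tensor4_eq => i j k l; rewrite !ev_fun4.
have cE x y z w : c x y z w = \sum_m \sum_n M x m * inv_metric E m n * ev Phi [:: n; y; z; w].
  rewrite exchange_big; apply: eq_bigr => n _ /=.
  by rewrite mulr_suml; apply: eq_bigr => m _; rewrite ev_mx [M x m * _]mulrC.
rewrite !cE -!sumrB -!big_split -sumrB /=; apply: eq_bigr => m _.
rewrite -!sumrB -!big_split -sumrB /=; apply: eq_bigr => n _.
have [F1 F2 F3] := all_and3 (fun i => all_and3 (fun j => all_and3 (fun k =>
  all_and3 (form4_swaps form_Phi i j k)))).
rewrite !comp4E (F1 i n) (F2 i j n) (F1 i n) (F3 i j k n) (F2 i j n) (F1 i n).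
ring.
Qed.

Lemma pullback_mx A (M : 'M[R]_8) :
  tensor_of_mx (A^T *m M *m A) = pullback A (tensor_of_mx M).
Proof.
apply: tensor_eq => -[|i [|j [|? ?]]] // _; rewrite ev_mx ev_pullback //=.
rewrite mxE; under [LHS]eq_bigr => q _ do rewrite mxE mulr_suml.
rewrite exchange_big; apply: eq_bigr => p _ /=; rewrite mulr_sumr.
by apply: eq_bigr => q _; rewrite ev_mx ?mxE; ring.
Qed.

Lemma Dop_pullback Phi E A M : is_form Phi -> E \in unitmx -> A \in unitmx ->
  Dop (pullback A Phi) (E *m A) (A^T *m M *m A) = pullback A (Dop Phi E M).
Proof.
move=> form_Phi uE uA; rewrite !Dop_contract1 //; last exact: form_pullback.
apply: pullback_fun4 => i j k l.
have cE x y z w : contract1 (pullback A Phi) (E *m A) (A^T *m M *m A) x y z w =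
    quad A (contract1 Phi E M) x y z w.
  rewrite /contract1 pullback_mx contraction_pullback //.
set c := contract1 Phi E M in cE *; rewrite !cE.
rewrite quadD (quadN A (fun i j k l => c l i j k)) quadD.
rewrite quadD (quadN A (fun i j k l => c j i k l)).
by rewrite (quad_swap12 A c) (quad_kijl A c) (quad_lijk A c).
Qed.

(** The six terms run over the ways of choosing a pair of indices for [s] and leaving the
    complementary pair to [Phi]. Since [c] is antisymmetric within each pair, a swap of neighbouring
    indices permutes the six terms with an overall sign. *)
Lemma form_Lambda Phi E s : is_form Phi -> is_form s -> is_form (Lambda Phi E s).
Proof.
move=> form_Phi form_s.
set c := contract2 Phi E s.
have c12 i j k l : c i j k l = - c j i k l.
  rewrite /c /contract2 -sumrN; apply: eq_bigr => m _; rewrite -sumrN.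
  apply: eq_bigr => n _; rewrite -sumrN; apply: eq_bigr => a _; rewrite -sumrN.
  apply: eq_bigr => b _; rewrite !comp4E.
  by case: (form4_swaps form_s i j m n) => -> _ _; rewrite !mulNr.
have c34 i j k l : c i j k l = - c i j l k.
  rewrite /c /contract2 -sumrN; apply: eq_bigr => m _; rewrite -sumrN.
  apply: eq_bigr => n _; rewrite -sumrN; apply: eq_bigr => a _; rewrite -sumrN.
  apply: eq_bigr => b _; rewrite !comp4E.
  by case: (form4_swaps form_Phi a b k l) => _ _ ->; rewrite !mulrN.
apply: form4_of_swaps => i j k l; rewrite !ev_fun4 -/c; split.
- rewrite (c12 i j) (c34 i k l j) (c34 i l j k) (c34 j k i l) (c34 j l k i) (c34 k l i j); ring.
- rewrite (c34 i j k l) (c34 i k l j) (c34 i l j k) (c12 j k) (c34 j l k i) (c34 k l i j); ring.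
- rewrite (c34 i j k l) (c34 i k l j) (c34 i l j k) (c34 j k i l) (c34 j l k i) (c12 k l); ring.
Qed.

Lemma form_Dop Phi E M : is_form Phi -> is_form (Dop Phi E M).
Proof.
move=> form_Phi; rewrite Dop_contract1 //.
set c := contract1 Phi E M.
have c23 i j k l : c i j k l = - c i k j l.
  rewrite /c /contract1 /contraction /dot /= -sumrN; apply: eq_bigr => n _.
  by case: (form4_swaps form_Phi n j k l) => _ -> _; rewrite mulrN.
have c34 i j k l : c i j k l = - c i j l k.
  rewrite /c /contract1 /contraction /dot /= -sumrN; apply: eq_bigr => n _.
  by case: (form4_swaps form_Phi n j k l) => _ _ ->; rewrite mulrN.
apply: form4_of_swaps => i j k l; rewrite !ev_fun4; split.
- rewrite (c23 k i j l) (c23 l i j k); ring.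
- rewrite (c23 i j k l) (c34 l i j k); ring.
- rewrite (c34 i j k l) (c34 j i k l); ring.
Qed.

Lemma alternating_contraction h k m f g :
  alternating (k + m) g -> alternating m (fun t => contraction h k f g [::] t : R).
Proof.
move=> alt_g l1 x y l2 sz; rewrite /contraction /dot -mulN1r -ssumZ.
apply: eq_ssum => u sz_u; rewrite catA alt_g; last by rewrite -catA size_cat sz_u sz.
by rewrite -catA mulrN mulN1r.
Qed.

Lemma form_hodge k m (km : (k + m = 8)%N) E (a : tensor R k) :
  is_form (hodge km E a).
Proof.
apply/form_alternating => l1 x y l2 sz.
have sz' : size (l1 ++ y :: x :: l2) = m by rewrite -sz !size_cat.
rewrite !ev_hodge // (@alternating_contraction _ _ m) ?mulrN //.
by rewrite km; apply/form_alternating; exact: form_coframe_wedge.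
Qed.

(** Contract the volume form with [a] first, which leaves the star of [a], and then with [b]. For
    the self-dual [Phi] this turns the condition defining Omega^2_7 into a contraction with [Phi]
    itself. *)
Lemma hodge6_wedge E (a : tensor R 4) (b : tensor R 2) l : size l = 2 ->
  ev (hodge6 E (wedge a b)) l =
  2^-1 * contraction (inv_metric E) 2 (ev b) (ev (hodge4 E a)) [::] l.
Proof.
move=> sz_l; set h := inv_metric E.
(* The volume form with its last two slots frozen at [l]. *)
pose V : tensor R 6 := [ffun t : 6.-tuple 'I_8 => ev (volume E) (t ++ l)].
have evV u : size u = 6 -> ev V u = ev (volume E) (u ++ l).
  move=> sz_u; pose t := tcast sz_u (in_tuple u).
  have -> : u = t by rewrite val_tcast.
  by rewrite ev_tuple ffunE.
have form_vol : alternating 8 (ev (volume E)).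
  by apply/form_alternating; exact: form_coframe_wedge.
have form_V : is_form V.
  apply/form_alternating => l1 x y l2 sz.
  rewrite !evV //; last by move: sz; rewrite !size_cat.
  rewrite -!catA /= form_vol //.
  by rewrite -cat_cons -cat_cons catA size_cat sz sz_l.
pose G := pullback h V; have form_G : is_form G by exact: form_pullback.
transitivity (6`!%:R^-1 * \sum_(s : 6.-tuple 'I_8) wedge a b s * G s).
  rewrite ev_hodge //; congr (_ * _); rewrite /contraction dot_pbl trmxK /dot.
  rewrite -ssum_tuple; apply: eq_bigr => s _.
  rewrite -!ev_tuple ev_pullback ?size_tuple //; congr (_ * _).
  by apply: eq_pbl => v; rewrite size_tuple => /evV.
transitivity ((4`! * 2`!)%:R^-1 *
    \sum_(s : 6.-tuple 'I_8) ev a (take 4 s) * ev b (drop 4 s) * G s).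
  (* Against the antisymmetric [G], each of the 6! terms of the wedge contributes the same amount:
     reindexing by [p] produces a second sign of [p]. The 6! copies then cancel the normalisation of
     the star. *)
  have -> : \sum_(s : 6.-tuple 'I_8) wedge a b s * G s = (4`! * 2`!)%:R^-1 *
    \sum_(p : 'S_6) \sum_(s : 6.-tuple 'I_8) ev a (take 4 s) * ev b (drop 4 s) * G s.
    rewrite mulr_sumr.
    transitivity ((4`! * 2`!)%:R^-1 * (\sum_(s : 6.-tuple 'I_8) \sum_(p : 'S_6)
      ((-1) ^+ p * (a [tuple tnth s (p (lshift 2 u)) | u < 4] *
        b [tuple tnth s (p (rshift 4 v)) | v < 2]) * G s))).
      rewrite mulr_sumr; apply: eq_bigr => s _; rewrite ffunE -mulrA mulr_suml.
      by congr (_ * _); apply: eq_bigr => p _.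
    rewrite exchange_big /= mulr_sumr; apply: eq_bigr => p _; congr (_ * _).
    rewrite [RHS](reindex (fun s : 6.-tuple 'I_8 => [tuple tnth s (p u) | u < 6])) /=; last first.
      exists (fun r : 6.-tuple 'I_8 => [tuple tnth r (p^-1%g u) | u < 6]) => r _;
      by apply: eq_from_tnth => u; rewrite !tnth_mktuple ?permKV ?permK.
    apply: eq_bigr => s _; rewrite form_G [RHS]mulrCA -mulrA.
    congr (_ * (_ * _ * _)); congr (_ _); apply: eq_from_tnth => u.
      rewrite !tnth_mktuple nth_take // -[nat_of_ord u]/(nat_of_ord (lshift 2 u)).
      by rewrite nth_mktuple.
    rewrite !tnth_mktuple nth_drop -[(4 + u)%N]/(nat_of_ord (rshift 4 u)).
    by rewrite nth_mktuple.
  rewrite (eq_bigl [in [set: 'S_6]]); last by move=> p; rewrite inE.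
  rewrite sumr_const cardsT card_Sn mulrCA -[in X in _ * (_ * X)]mulr_natl mulKf //.
  by rewrite pnatr_eq0 -lt0n fact_gt0.
have -> : \sum_(s : 6.-tuple 'I_8) ev a (take 4 s) * ev b (drop 4 s) * G s =
    ssum 6 (fun s => ev a (take 4 s) * ev b (drop 4 s) * ev G s).
  by rewrite -ssum_tuple; apply: eq_bigr => s _; rewrite ev_tuple.
rewrite (ssum_cat 4 2) ssum_ssum.
(* Summing over the first four slots gives 4! times the star of [a], with [h] still acting on the
   two slots paired with [b]. *)
transitivity ((4`! * 2`!)%:R^-1 * ssum 2 (fun v => ev b v * pbl h (fun v' =>
   4`!%:R * ev (hodge4 E a) (v' ++ l)) v)).
  congr (_ * _); apply: eq_ssum => v sz_v.
  transitivity (ev b v * ssum 4 (fun u => ev a u * ev G (u ++ v))).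
    rewrite -ssumZ; apply: eq_ssum => u sz_u.
    by rewrite take_size_cat // drop_size_cat // mulrAC mulrC mulrA.
  congr (_ * _).
  transitivity (ssum 4 (fun u => pbl h (fun v' => ev a u * pbl h (fun u' =>
      ev (volume E) (u' ++ v' ++ l)) u) v)).
    apply: eq_ssum => u sz_u; rewrite pblZ; congr (_ * _).
    rewrite ev_pullback ?size_cat ?sz_u ?sz_v // pbl_cat pbl_pbl.
    apply: eq_pbl => v' sz_v'; apply: eq_pbl => u' sz_u'.
    by rewrite evV ?size_cat ?sz_v' ?sz_v ?sz_u' ?sz_u // catA.
  rewrite -pbl_ssum; apply: eq_pbl => v' sz_v'.
  rewrite ev_hodge ?size_cat ?sz_v' ?sz_v ?sz_l // mulVKf; last first.
    by rewrite pnatr_eq0 -lt0n fact_gt0.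
  by rewrite /contraction dot_pbl trmxK.
under eq_ssum => v _ do rewrite pblZ mulrCA.
rewrite ssumZ mulrA; congr (_ * _).
  rewrite natrM invfM mulrAC mulVf ?mul1r //.
  by rewrite pnatr_eq0 -lt0n fact_gt0.
by rewrite /contraction dot_pbl inv_metric_sym.
Qed.

End Naturality.

(** * Formal integer combinations of components *)

Fixpoint insert_sign (x : nat) (l : seq nat) : int * seq nat :=
  if l is y :: l' then
    if (x < y)%N then (1, x :: l)
    else if x == y then (0, x :: l)
    else let: (c, m) := insert_sign x l' in (- c, y :: m)
  else (1, [:: x]).

(* The sign is 0 when an entry is repeated. *)
Fixpoint sort_sign (l : seq nat) : int * seq nat :=
  if l is x :: l' then
    let: (c, m) := sort_sign l' in
    let: (d, n) := insert_sign x m in (c * d, n)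
  else (1, [::]).

(** A pair [(c, l)] stands for [c] times the component at [l] of a tensor that is left
    unspecified. *)
Notation linexp := (seq (int * seq nat)).

Fixpoint add_term (c : int) (l : seq nat) (e : linexp) : linexp :=
  if e is (d, m) :: e' then
    if l == m then (c + d, m) :: e' else (d, m) :: add_term c l e'
  else [:: (c, l)].

(** The normal form [nrm] is a parameter because forms are sorted with a sign, symmetric matrices
    without one. *)
Fixpoint collect (nrm : seq nat -> int * seq nat) (e : linexp) : linexp :=
  if e is (c, l) :: e' then
    let: (d, m) := nrm l in let: r := collect nrm e' in
    if c * d == 0 then r else add_term (c * d) m r
  else [::].

(** The lengths are checked because normalisation is only sound on lists of length [k]. *)
Definition cancels k nrm (e : linexp) : bool :=
  all (fun q => size q.2 == k) e && all (fun q => q.1 == 0) (collect nrm e).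

Fixpoint lists k : seq (seq nat) :=
  if k is k'.+1 then [seq i :: l | i <- iota 0 8, l <- lists k'] else [:: [::]].

(** Increasing lists index the independent components of a k-form. *)
Definition keys k := [seq l <- lists k | sorted ltn l].

Section NumericComponents.
Variable R : realType.
Implicit Types (F : seq nat -> R) (e : linexp).

Definition evl F e : R := \sum_(q <- e) q.1%:~R * F q.2.

Lemma evl_cat F e1 e2 : evl F (e1 ++ e2) = evl F e1 + evl F e2.
Proof. exact: big_cat. Qed.

Lemma evl_add_term F c l e : evl F (add_term c l e) = c%:~R * F l + evl F e.
Proof.
elim: e => [|[d m] e IHe] /=; first by rewrite /evl !big_cons big_nil.
case: eqP => [->|_]; rewrite /evl !big_cons /=; first by rewrite intrD; ring.
by rewrite -/(evl _ _) IHe addrCA.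
Qed.

Lemma evl_collect k nrm F e :
    (forall l, size l = k -> F l = (nrm l).1%:~R * F (nrm l).2) ->
    all (fun q => size q.2 == k) e ->
  evl F (collect nrm e) = evl F e.
Proof.
move=> nrmP; elim: e => [|[c l] e IHe] //= /andP[/eqP sz_l /IHe{}IHe].
rewrite [in RHS]/evl big_cons /= -/(evl F e) (nrmP l) //.
case: (nrm l) => d m /=; rewrite mulrA -intrM.
by case: eqP => [->|_]; rewrite ?evl_add_term IHe // mul0r add0r.
Qed.

(** The soundness principle behind the cancellation checks: a formal sum that cancels gives an
    identity for every tensor with the symmetry encoded by [nrm]. *)
Lemma evl_cancels k nrm F e :
    (forall l, size l = k -> F l = (nrm l).1%:~R * F (nrm l).2) ->
  cancels k nrm e -> evl F e = 0.
Proof.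
move=> nrmP /andP[sz_e /allP z_e]; rewrite -(evl_collect nrmP sz_e) /evl.
by apply: big1_seq => q /= /z_e /eqP ->; rewrite mul0r.
Qed.

Lemma insert_sign_sound k F p x l :
    (forall l1 x y l2, size (l1 ++ x :: y :: l2) = k ->
       F (l1 ++ x :: y :: l2) = - F (l1 ++ y :: x :: l2)) ->
    size (p ++ x :: l) = k ->
  F (p ++ x :: l) = (insert_sign x l).1%:~R * F (p ++ (insert_sign x l).2).
Proof.
move=> swap; elim: l p => [|y l IHl] p sz /=; first by rewrite mul1r.
case: ltngtP => [_|_|eq_xy] /=; first by rewrite mul1r.
  case: (insert_sign x l) (IHl (rcons p y)) => c m /= IH.
  rewrite swap // -cat_rcons IH.
    by rewrite cat_rcons intrN mulNr.
  by rewrite -sz cat_rcons !size_cat.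
(* Equal neighbours: the swap gives F = - F, so the component vanishes, as the sign 0 predicts. *)
rewrite mul0r eq_xy; apply/eqP; move: (swap p x y l sz); rewrite eq_xy => /eqP.
by rewrite -addr_eq0 -mulr2n mulrn_eq0.
Qed.

Lemma size_insert_sign x l : size (insert_sign x l).2 = (size l).+1.
Proof.
elim: l => //= y l; case: ltngtP => //= _.
by case: (insert_sign x l) => c m /= ->.
Qed.

Lemma size_sort_sign l : size (sort_sign l).2 = size l.
Proof.
elim: l => //= x l; case: (sort_sign l) => c m /= <-.
by move: (size_insert_sign x m); case: (insert_sign x m).
Qed.

Lemma sort_sign_sound k F l :
    (forall l1 x y l2, size (l1 ++ x :: y :: l2) = k ->
       F (l1 ++ x :: y :: l2) = - F (l1 ++ y :: x :: l2)) ->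
  size l = k -> F l = (sort_sign l).1%:~R * F (sort_sign l).2.
Proof.
move=> swap sz.
suff: forall p, size (p ++ l) = k ->
    F (p ++ l) = (sort_sign l).1%:~R * F (p ++ (sort_sign l).2) by move=> /(_ [::] sz).
elim: l {sz} => [|x l IHl] p sz /=; first by rewrite mul1r.
have := size_sort_sign l.
case: (sort_sign l) (IHl (rcons p x)) => c m /= IH sz_m.
have := @insert_sign_sound k F p x m swap.
case: (insert_sign x m) => d n /= ins.
rewrite -cat_rcons IH; last by rewrite cat_rcons.
by rewrite cat_rcons ins ?intrM ?mulrA // -sz !size_cat /= sz_m.
Qed.
End NumericComponents.

(** The 14 monomials inside the bracket of [spin7_form], with indices shifted to start at 0; the
    overall minus sign is supplied by [phi_sorted]. *)
Definition phi_terms : seq (seq nat * int) :=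
  [seq (l, 1) | l <- [:: [:: 0; 1; 2; 3]; [:: 0; 1; 4; 5]; [:: 0; 1; 6; 7];
    [:: 2; 3; 4; 5]; [:: 2; 3; 6; 7]; [:: 4; 5; 6; 7]; [:: 0; 2; 4; 6];
    [:: 1; 3; 5; 7]]%N] ++
  [seq (l, -1) | l <- [:: [:: 0; 2; 5; 7]; [:: 0; 3; 4; 7]; [:: 0; 3; 5; 6];
    [:: 1; 2; 4; 7]; [:: 1; 2; 5; 6]; [:: 1; 3; 4; 6]]%N].

Definition phi_sorted (m : seq nat) : int :=
  foldr (fun q r => if m == q.1 then - q.2 + r else r) 0 phi_terms.

Definition phiN (l : seq nat) : int :=
  let: (c, m) := sort_sign l in if c == 0 then 0 else c * phi_sorted m.

Lemma mem_lists k l : (l \in lists k) = (size l == k) && all (gtn 8) l.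
Proof.
elim: k l => [|k IHk] l; first by case: l.
have -> : lists k.+1 = [seq i :: m | i <- iota 0 8, m <- lists k] by [].
apply/allpairsP/idP => [[[i m] []]|].
  by rewrite mem_iota IHk /= => i_lt /andP[/eqP<- sub] ->; rewrite /= eqxx sub i_lt.
case: l => // i l sub; exists (i, l); rewrite mem_iota IHk.
by move: sub => /= /and3P[sz -> ->]; rewrite -eqSS sz.
Qed.

Lemma mem_keys k l : (l \in keys k) = [&& sorted ltn l, size l == k & all (gtn 8) l].
Proof. by rewrite mem_filter mem_lists. Qed.

Lemma keys_lists k m : m \in keys k -> m \in lists k.
Proof. by rewrite mem_filter => /andP[]. Qed.

Definition sorts_to_keys k := all (fun l =>
  let: (c, m) := sort_sign l in (c == 0) || sorted ltn m && all (gtn 8) m) (lists k).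

Lemma sort_sign_keys k l : sorts_to_keys k -> l \in lists k ->
  (sort_sign l).1 != 0 -> (sort_sign l).2 \in keys k.
Proof.
move=> /allP chk l_in; move: (chk l l_in) (size_sort_sign l).
move: l_in; rewrite mem_lists mem_keys => /andP[/eqP-> _].
by case: (sort_sign l) => c m /= /orP[->|/andP[-> ->] ->]; rewrite ?eqxx.
Qed.

Lemma sorts_to_keys4 : sorts_to_keys 4.
Proof. by vm_cast_no_check (erefl true). Qed.

(** * Components of the standard form and volume *)

Section StandardComponents.
Variable R : realType.
Local Notation ordn := (fun n : nat => inord n : 'I_8).

(** Numbers instead of ordinals let the checks compute. [inord] sends numbers from 8 on to 0, whence
    the conditions [l \in lists k] below. *)
Definition evn k (a : tensor R k) (l : seq nat) : R := ev a (map ordn l).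

Lemma sum_iota (F : 'I_8 -> R) : \sum_i F i = \sum_(n <- iota 0 8) F (inord n).
Proof.
rewrite -[iota 0 8]/(index_iota 0 8) big_mkord.
by apply: eq_bigr => i _; rewrite inord_val.
Qed.

Lemma ssum_lists k (f : seq 'I_8 -> R) : ssum k f = \sum_(l <- lists k) f (map ordn l).
Proof.
elim: k f => [|k IHk] f; first by rewrite big_seq1.
by rewrite [RHS]big_allpairs_dep /= -/(iota 0 8) sum_iota; apply: eq_bigr => i _; rewrite IHk.
Qed.

Lemma evn_swap k (a : tensor R k) l1 x y l2 : is_form a ->
    size (l1 ++ x :: y :: l2) = k ->
  evn a (l1 ++ x :: y :: l2) = - evn a (l1 ++ y :: x :: l2).
Proof.
move=> /form_alternating alt_a sz; rewrite /evn !map_cat /= alt_a //.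
by move: sz; rewrite !size_cat /= !size_map.
Qed.

Lemma evn_sort k (a : tensor R k) l : is_form a -> size l = k ->
  evn a l = (sort_sign l).1%:~R * evn a (sort_sign l).2.
Proof. by move=> form_a; apply: sort_sign_sound => *; exact: evn_swap. Qed.

Lemma mapK_ord (l : seq 'I_8) : map ordn (map val l) = l.
Proof. by rewrite -map_comp map_id_in // => i _ /=; rewrite inord_val. Qed.

Lemma val_lists k (l : seq 'I_8) : size l = k -> map val l \in lists k.
Proof.
move=> sz; rewrite mem_lists size_map sz eqxx /=.
by apply/allP => _ /mapP[i _ ->] /=; exact: ltn_ord.
Qed.

Lemma form_eq_keys k (a b : tensor R k) :
    sorts_to_keys k -> is_form a -> is_form b ->
  (forall l, l \in keys k -> evn a l = evn b l) -> a = b.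
Proof.
move=> chk form_a form_b eq_ab; apply: tensor_eq => l sz.
have evE (c : tensor R k) : ev c l = evn c (map val l) by rewrite /evn mapK_ord.
have sz_l : size (map val l) = k by rewrite size_map.
rewrite (evE a) (evE b) (evn_sort form_a sz_l) (evn_sort form_b sz_l).
have [->|nz] := eqVneq (sort_sign (map val l)).1 0; first by rewrite !mul0r.
by rewrite eq_ab // sort_sign_keys // val_lists.
Qed.

Lemma wedge1_self k (a : k.-tuple 'I_8) : uniq a ->
  coframe_wedge (1%:M : 'M[R]_8) a a = 1.
Proof.
move=> uniq_a; rewrite ffunE -[RHS](det1 _ k); congr (\det _).
apply/matrixP => u v; rewrite !mxE; congr (_%:R); congr nat_of_bool.
by apply/eqP/eqP => [|->//]; apply/tuple_uniqP.
Qed.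

Lemma wedge1_notin k (a t : k.-tuple 'I_8) x : x \in t -> x \notin a ->
  coframe_wedge (1%:M : 'M[R]_8) a t = 0.
Proof.
move=> /tnthP[v ->] x_notin; rewrite ffunE [LHS]/(\det _) big1 // => s _.
rewrite (bigD1 (s^-1%g v)) //= mxE permKV mxE.
case: eqP => [tE|_]; last by rewrite mul0r mulr0.
by rewrite -tE mem_tnth in x_notin.
Qed.

(** For the identity coframe, an index of [m] outside [a'] gives the minor a zero column. The last
    hypothesis asks for such an index whenever the lists differ; increasing lists of length 4
    satisfy it by [keys4_separated]. *)
Lemma evn_wedge1 k (a : k.-tuple 'I_8) (a' m : seq nat) :
    tval a = map ordn a' -> a' \in lists k -> uniq a' -> m \in lists k ->
    (a' != m) ==> has [predC a'] m ->
  evn (coframe_wedge 1%:M a) m = (m == a')%:R.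
Proof.
move=> aE; rewrite !mem_lists => /andP[_ /allP lt_a] uniq_a /andP[/eqP sz_m /allP lt_m].
have inj x y : (x < 8)%N -> (y < 8)%N -> ordn x = ordn y -> x = y.
  by move=> lt_x lt_y /(congr1 val); rewrite /= !inordK.
have sz : size (map ordn m) = k by rewrite size_map.
pose t := tcast sz (in_tuple (map ordn m)).
have tE : tval t = map ordn m by rewrite val_tcast.
rewrite /evn -tE ev_tuple eq_sym; case: eqVneq => [eq_am _|_ /= /hasP[x x_m x_a]].
  have -> : t = a by apply: val_inj; rewrite /= tE aE eq_am.
  rewrite wedge1_self // aE map_inj_in_uniq // => x y /lt_a lt_x /lt_a lt_y.
  exact: inj.
apply: (@wedge1_notin _ _ _ (ordn x)).
  by rewrite [_ \in _]/(_ \in tval t) tE; exact: (map_f ordn).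
rewrite [_ \in _]/(_ \in tval a) aE; apply/mapP => -[y y_a /inj eq_xy].
by move: x_a; rewrite (eq_xy (lt_m _ x_m) (lt_a _ y_a)) /= y_a.
Qed.

Lemma keys4_separated :
  all (fun a => uniq a && all (fun m => (a != m) ==> has [predC a] m) (keys 4)) (keys 4).
Proof. by vm_cast_no_check (erefl true). Qed.

Lemma evn_coframe_wedge4 i j k l m :
    [:: i.-1; j.-1; k.-1; l.-1] \in keys 4 -> m \in keys 4 ->
  evn (coframe_wedge4 1%:M i j k l) m = (m == [:: i.-1; j.-1; k.-1; l.-1])%:R.
Proof.
move=> key_a key_m; move/allP: keys4_separated => /(_ _ key_a) /andP[uniq_a /allP sep].
by apply: evn_wedge1; rewrite ?keys_lists ?sep.
Qed.

Notation Phi0 := (spin7_form (1%:M : 'M[R]_8)).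

Lemma evn_phi_sorted m : m \in keys 4 -> evn Phi0 m = (phi_sorted m)%:~R.
Proof.
move=> key_m.
have evnD (a b : tensor R 4) : evn (a + b) m = evn a m + evn b m by rewrite /evn /ev ffunE.
have evnN (a : tensor R 4) : evn (- a) m = - evn a m by rewrite /evn /ev ffunE.
rewrite /spin7_form !(evnD, evnN) !evn_coframe_wedge4 //=.
have addb (b : bool) (c r : int) :
    (if b then c + r else r)%:~R = c%:~R * b%:R + r%:~R :> R.
  by case: b; rewrite ?intrD ?mulr1 ?mulr0 ?add0r.
rewrite /phi_sorted /= !addb !intrN; ring.
Qed.

Lemma evn_phi l : l \in lists 4 -> evn Phi0 l = (phiN l)%:~R.
Proof.
move=> l_in; rewrite (evn_sort (form_spin7 _)); last first.
  by move: l_in; rewrite mem_lists => /andP[/eqP].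
rewrite /phiN; move: (sort_sign_keys sorts_to_keys4 l_in); case: (sort_sign l) => c m /=.
by case: eqP => [->|_ /(_ isT) key_m]; rewrite ?mul0r // evn_phi_sorted // intrM.
Qed.

Lemma volume_sorted : evn (volume (1%:M : 'M[R]_8)) (iota 0 8) = 1.
Proof.
have E : map ordn (iota 0 8) = ord_tuple 8.
  by rewrite -(mapK_ord (ord_tuple 8)) val_ord_tuple val_enum_ord.
by rewrite /evn E ev_tuple wedge1_self // val_ord_tuple enum_uniq.
Qed.

End StandardComponents.

Definition volN (l : seq nat) : int :=
  let: (c, m) := sort_sign l in if m == iota 0 8 then c else 0.

(** Increasing [K] suffice: the 4! orderings of each cancel the 1/4! in [hodge]. *)
Definition hodge_row (J : seq nat) : linexp := [seq (volN (K ++ J), K) | K <- keys 4].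

Lemma volN_sound : all (fun J => all (fun K =>
  let: (c, m) := sort_sign (K ++ J) in (c == 0) || (m == iota 0 8)) (keys 4)) (keys 4).
Proof. by vm_cast_no_check (erefl true). Qed.

Definition contract_row (i j k l : nat) : linexp :=
  [seq (phiN [:: m; n; k; l], [:: i; j; m; n]) | m <- iota 0 8, n <- iota 0 8].

Definition Lambda_row (i j k l : nat) : linexp :=
  contract_row i j k l ++ contract_row i k l j ++ contract_row i l j k ++
  contract_row j k i l ++ contract_row j l k i ++ contract_row k l i j.

Definition Dop_row (i j k l : nat) : linexp :=
  [seq (phiN [:: m; j; k; l], [:: i; m]) | m <- iota 0 8] ++
  [seq (phiN [:: i; m; k; l], [:: j; m]) | m <- iota 0 8] ++
  [seq (phiN [:: i; j; m; l], [:: k; m]) | m <- iota 0 8] ++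
  [seq (phiN [:: i; j; k; m], [:: l; m]) | m <- iota 0 8].

(** * Operators in the standard frame as formal sums *)

Section StandardOperators.
Variable R : realType.
Notation ordn := (fun n : nat => inord n : 'I_8).
Notation Phi0 := (spin7_form (1%:M : 'M[R]_8)).
Notation I8 := (1%:M : 'M[R]_8).

Lemma dot_keys (a b : tensor R 4) : is_form a -> is_form b ->
  dot 4 (ev a) (ev b) = 24%:R * \sum_(K <- keys 4) evn a K * evn b K.
Proof.
move=> form_a form_b; rewrite /dot ssum_lists.
(* A product of two components picks up the square of the sorting sign, so it is constant over the
   orderings of an increasing list and 0 on lists with a repetition; that there are 24 orderings is
   left to the cancellation check. *)
pose nrm l := let: (c, m) := sort_sign l in (c * c, m).
pose F l := evn a l * evn b l.
have nrmP l : size l = 4 -> F l = (nrm l).1%:~R * F (nrm l).2.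
  move=> sz; rewrite /F (evn_sort form_a sz) (evn_sort form_b sz) /nrm.
  by case: (sort_sign l) => c m /=; rewrite intrM; ring.
have := evl_cancels nrmP
  (e := [seq (1, l) | l <- lists 4] ++ [seq (- 24%:Z, K) | K <- keys 4]).
rewrite evl_cat /evl !big_map /= => /(_ _)/eqP; rewrite addr_eq0 -/evn.
rewrite -sumrN => /(_ _)/eqP H.
transitivity (\sum_(l <- lists 4) 1%:~R * F l); first by apply: eq_bigr => l _; rewrite mul1r.
rewrite H; first by rewrite mulr_sumr; apply: eq_bigr => K _; rewrite intrN mulNr opprK.
by vm_cast_no_check (erefl true).
Qed.

Lemma form_inner1 (a b : tensor R 4) : is_form a -> is_form b ->
  form_inner 1%:M a b = \sum_(K <- keys 4) evn a K * evn b K.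
Proof.
move=> form_a form_b.
rewrite form_inner_contraction inv_metric1 trmx1 /contraction.
have -> : dot 4 (pbl I8 (fun u => ev a ([::] ++ u))) (fun u => ev b (u ++ [::])) =
    dot 4 (ev a) (ev b).
  by apply: eq_ssum => u _; rewrite pbl1 cats0.
by rewrite dot_keys // mulKf // pnatr_eq0.
Qed.

Lemma hodge1_row (a : tensor R 4) J : is_form a -> J \in keys 4 ->
  evn (hodge4 1%:M a) J = evl (evn a) (hodge_row J).
Proof.
move=> form_a key_J; rewrite /evn ev_hodge; last first.
  by move/keys_lists: key_J; rewrite mem_lists size_map => /andP[/eqP].
have sz_J : size (map ordn J) = 4.
  by move/keys_lists: key_J; rewrite mem_lists size_map => /andP[/eqP].
pose V : tensor R 4 := [ffun t : 4.-tuple 'I_8 => ev (volume I8) (t ++ map ordn J)].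
have evV u : size u = 4 -> ev V u = ev (volume I8) (u ++ map ordn J).
  move=> sz_u; pose t := tcast sz_u (in_tuple u).
  have -> : u = t by rewrite val_tcast.
  by rewrite ev_tuple ffunE.
have form_vol : is_form (volume I8) by exact: form_coframe_wedge.
have form_V : is_form V.
  apply/form_alternating => l1 x y l2 sz.
  have alt_vol : alternating 8 (ev (volume I8)) by apply/form_alternating.
  rewrite !evV //; last by move: sz; rewrite !size_cat.
  rewrite -!catA /= alt_vol //.
  by rewrite -cat_cons -cat_cons catA size_cat sz sz_J.
transitivity (4`!%:R^-1 * dot 4 (ev a) (ev V)).
  congr (_ * _); rewrite inv_metric1 trmx1; apply: eq_ssum => u sz_u.
  by rewrite pbl1 evV.
rewrite dot_keys // mulKf ?pnatr_eq0 // /evl big_map.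
apply: eq_big_seq => K key_K; rewrite mulrC; congr (_ * _).
have sz_K : size K = 4 by move/keys_lists: key_K; rewrite mem_lists => /andP[/eqP].
rewrite /evn evV ?size_map // -map_cat -/(evn _ _).
rewrite (evn_sort form_vol) ?size_cat ?sz_K; last by rewrite -(size_map ordn J) sz_J.
move/allP: volN_sound => /(_ _ key_J) /allP/(_ _ key_K); rewrite /volN.
case: (sort_sign _) => c m /=; case: (m =P _) => [->|_]; last first.
  by rewrite orbF => /eqP->; rewrite mul0r.
by rewrite volume_sorted mulr1.
Qed.

Lemma evn_Lambda (s : tensor R 4) i j k l : [:: i; j; k; l] \in lists 4 ->
  evn (Lambda Phi0 1%:M s) [:: i; j; k; l] = evl (evn s) (Lambda_row i j k l).
Proof.
rewrite mem_lists /= => /and5P[lt_i lt_j lt_k lt_l _].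
have cE x y z w : (x < 8)%N -> (y < 8)%N -> (z < 8)%N -> (w < 8)%N ->
    contract2 Phi0 1%:M s (inord x) (inord y) (inord z) (inord w) =
    evl (evn s) (contract_row x y z w).
  move=> lt_x lt_y lt_z lt_w; rewrite contract2_contraction inv_metric1.
  rewrite /evl big_allpairs_dep /contraction /dot /= sum_iota.
  apply: eq_big_seq => m m_in; rewrite sum_iota; apply: eq_big_seq => n n_in /=.
  rewrite -[\sum_(j0 < 8) _]/(pbl I8
    (fun u => ev s ([:: inord x; inord y] ++ u)) [:: inord m; inord n]).
  rewrite pbl1 mulrC; congr (_ * _); rewrite -evn_phi //.
  by rewrite mem_lists /= lt_z lt_w; move: m_in n_in; rewrite !mem_iota /= => -> ->.
by rewrite /evn [map _ _]/= ev_fun4 !cE // /Lambda_row !evl_cat !addrA.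
Qed.

Lemma evn_Dop (M : 'M[R]_8) i j k l : [:: i; j; k; l] \in lists 4 ->
  evn (Dop Phi0 1%:M M) [:: i; j; k; l] = evl (evn (tensor_of_mx M)) (Dop_row i j k l).
Proof.
rewrite mem_lists /= => /and5P[lt_i lt_j lt_k lt_l _].
rewrite /evn [map _ _]/= ev_fun4 sum_iota /Dop_row !evl_cat /evl !big_map.
rewrite -!big_split; apply: eq_big_seq => m; rewrite mem_iota /= => lt_m.
rewrite inv_metric1 (bigD1 (inord m)) //= big1 => [|n /negbTE ne_nm]; last first.
  by rewrite mxE eq_sym ne_nm !mulr0 !mul0r !addr0.
rewrite !mxE eqxx !mulr1 addr0 -!addrA; do 3?[congr (_ + _)];
  by rewrite mulrC -evn_phi ?mem_lists /= ?lt_i ?lt_j ?lt_k ?lt_l ?lt_m // /evn ev_mx comp4E.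
Qed.

End StandardOperators.

(** * Identities in the standard frame *)

Definition scale_lin (c : int) (e : linexp) : linexp := [seq (c * q.1, q.2) | q <- e].

(** Composition of operators given by rows: every symbol is replaced by its expansion. *)
Definition bind_lin (r : seq nat -> linexp) (e : linexp) : linexp :=
  flatten [seq if q.1 == 0 then [::] else scale_lin q.1 (r q.2) | q <- e].

(** Integer counterpart of [evl], for tensors whose components are known numbers. *)
Definition evz (G : seq nat -> int) (e : linexp) : int :=
  foldr (fun q r => if q.1 == 0 then r else q.1 * G q.2 + r) 0 e.

(* Components of the 2-form e^{0b} - *(Phi /\ e^{0b}), which lies in Omega^2_7. *)
Definition betaN (b : nat) (l : seq nat) : int :=
  (l == [:: 0; b]%N)%:Z - (l == [:: b; 0]%N)%:Z - phiN [:: 0, b & l]%N.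

Definition Dop_row_of (J : seq nat) : linexp :=
  if J is [:: i; j; k; l] then Dop_row i j k l else [::].

Definition Lambda_row_of (J : seq nat) : linexp :=
  if J is [:: i; j; k; l] then Lambda_row i j k l else [::].

(** Evaluated once, to be looked up by the later checks; [Dbeta_check] certifies it against D. *)
Definition Dbeta_table : seq (seq (int * seq nat)) := Eval vm_compute in
  [seq [seq q <- [seq (evz (betaN b) (Dop_row_of K), K) | K <- keys 4] | q.1 != 0]
  | b <- iota 1 7].

(* [b] is shifted down by one: [DbetaN b] belongs to [betaN b.+1]. *)
Definition DbetaN (b : nat) (K : seq nat) : int :=
  foldr (fun q r => if K == q.2 then q.1 + r else r) 0 (nth [::] Dbeta_table b).

(** The normal form for symmetric matrices, where exchanging the two indices costs no sign. *)
Definition sorted_pair (l : seq nat) : int * seq nat :=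
  if l is [:: i; j] then (1, if (i <= j)%N then l else [:: j; i]) else (1, l).

(* Symmetrization of sigma_{iklm} Phi_{jklm}; up to a factor it inverts D on
   anti-self-dual forms. *)
Definition sym_row (i j : nat) : linexp :=
  [seq (phiN (j :: K), i :: K) | K <- keys 3] ++
  [seq (phiN (i :: K), j :: K) | K <- keys 3].

Lemma star_star_check :
  all (fun J => cancels 4 sort_sign ((-1, J) :: bind_lin hodge_row (hodge_row J))) (keys 4).
Proof. by vm_cast_no_check (erefl true). Qed.

Lemma star_phi_check : all (fun J => evz phiN (hodge_row J) == phiN J) (keys 4).
Proof. by vm_cast_no_check (erefl true). Qed.

Lemma Dbeta_check : all (fun b => all (fun K =>
  evz (betaN b.+1) (Dop_row_of K) == DbetaN b K) (keys 4)) (iota 0 7).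
Proof. by vm_cast_no_check (erefl true). Qed.

Lemma star_Dbeta_check :
  all (fun J => let r := hodge_row J in
    all (fun b => evz (DbetaN b) r == DbetaN b J) (iota 0 7)) (keys 4).
Proof. by vm_cast_no_check (erefl true). Qed.

Definition dotN (u v : seq nat -> int) : int :=
  foldr (fun K r => u K * v K + r) 0 (keys 4).

Lemma inner_check : [&& dotN phiN phiN == 14,
  all (fun b => dotN phiN (DbetaN b) == 0) (iota 0 7) &
  all (fun a => all (fun b =>
    dotN (DbetaN a) (DbetaN b) == if a == b then 128 else 0) (iota 0 7)) (iota 0 7)].
Proof. by vm_cast_no_check (erefl true). Qed.

(** Row [J] of the operator s -> <u, s> u; rows with [u J = 0] are left empty to shorten the
    checks. *)
Definition rank1_row (u : seq nat -> int) (J : seq nat) : linexp :=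
  let c := u J in if c == 0 then [::] else [seq (c * u K, K) | K <- keys 4].

(** The target is Lambda(s) = 2 (s + star s) - 28 P_1 s - 16 P_7 s, with P_1 and P_7 the orthogonal
    projections to Phi and to the D(beta_b). Dividing by the squared norms 14 and 128 leaves the
    weights 2 and 1/8, and the factor 8 clears the denominator. *)
Lemma Lambda_check : all (fun J => cancels 4 sort_sign
  (scale_lin 8 (Lambda_row_of J) ++ [:: (- 16%:Z, J)] ++ scale_lin (- 16%:Z) (hodge_row J) ++
   scale_lin 16 (rank1_row phiN J) ++
   flatten [seq rank1_row (DbetaN b) J | b <- iota 0 7])) (keys 4).
Proof. by vm_cast_no_check (erefl true). Qed.

(* The star exchanges the index sets that contain 0 with those that do not, so an
   eigenform of the star is determined by its 35 components that involve 0. *)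
Lemma complement_check : all (fun J => (0%N \in J) ||
  all (fun q => (q.1 == 0) || (0%N \in q.2)) (hodge_row J)) (keys 4).
Proof. by vm_cast_no_check (erefl true). Qed.

(** On antisymmetric M, D sees only the part in Omega^2_7, because the complement of dimension 21 is
    the Lie algebra of the stabilizer of Phi. The beta_b are orthogonal of squared norm 4, so that
    part is a quarter of sum_b <beta_b, M> beta_b. *)
Lemma Dop_antisym_check : all (fun J => cancels 2 sort_sign
  (scale_lin (- 4%:Z) (Dop_row_of J) ++
   flatten [seq let c := DbetaN b J in
     if c == 0 then [::] else [seq (c * betaN b.+1 l, l) | l <- keys 2] | b <- iota 0 7]))
  (keys 4).
Proof. by vm_cast_no_check (erefl true). Qed.

(** The relation D(M) + star D(M) = tr(M) Phi for symmetric M; it makes D(M) anti-self-dual when the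
    trace is zero. *)
Lemma Dop_sym_check : all (fun J => cancels 2 sorted_pair
  (Dop_row_of J ++ bind_lin Dop_row_of (hodge_row J) ++
   [seq (- phiN J, [:: m; m]) | m <- iota 0 8])) (keys 4).
Proof. by vm_cast_no_check (erefl true). Qed.

(** With S the operator of [sym_row], this is D(S s) = 4 s - 4 star s + 4 <Phi, s> Phi, which is 8 s
    when s is anti-self-dual. *)
Lemma Dop_sym_row_check : all (fun J => cancels 4 sort_sign
  (bind_lin (fun l => sym_row (nth 0%N l 0) (nth 0%N l 1)) (Dop_row_of J) ++
   [:: (- 4%:Z, J)] ++ scale_lin 4 (hodge_row J) ++
   scale_lin (- 4%:Z) (rank1_row phiN J))) (keys 4).
Proof. by vm_cast_no_check (erefl true). Qed.

(** The trace of S s is 8 <Phi, s>: an increasing list has four choices of first index, and the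
    symmetrization doubles the trace. *)
Lemma trace_sym_row_check : cancels 4 sort_sign
  (flatten [seq sym_row i i | i <- iota 0 8] ++ [seq (- 8%:Z * phiN K, K) | K <- keys 4]).
Proof. by vm_cast_no_check (erefl true). Qed.

Lemma beta_antisym_check :
  all (fun b => all (fun l => betaN b.+1 l == - betaN b.+1 (rev l)) (lists 2)) (iota 0 7).
Proof. by vm_cast_no_check (erefl true). Qed.

(** The factor is -6, twice the eigenvalue -3, because the sum runs over ordered pairs. *)
Lemma beta_eigen_check : all (fun b => all (fun l =>
  foldr (fun p r => betaN b.+1 p * phiN (p ++ l) + r) 0 (lists 2) == - 6%:Z * betaN b.+1 l)
  (lists 2)) (iota 0 7).
Proof. by vm_cast_no_check (erefl true). Qed.

Section StandardIdentities.
Variable R : realType.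
Implicit Types (s : tensor R 4) (e : linexp).
Notation ordn := (fun n : nat => inord n : 'I_8).
Notation I8 := (1%:M : 'M[R]_8).
Notation Phi0 := (spin7_form I8).

Lemma evl_scale F c e : evl F (scale_lin c e) = c%:~R * evl F e :> R.
Proof.
rewrite /evl big_map mulr_sumr; apply: eq_bigr => q _ /=.
by rewrite intrM mulrA.
Qed.

Lemma evl_cons F q e : evl F (q :: e) = q.1%:~R * F q.2 + evl F e :> R.
Proof. exact: big_cons. Qed.

Lemma evl_nil F : evl F [::] = 0 :> R.
Proof. exact: big_nil. Qed.

Lemma evl_flatten F (T : Type) (r : T -> linexp) (l : seq T) :
  evl F (flatten [seq r x | x <- l]) = \sum_(x <- l) evl F (r x) :> R.
Proof.
elim: l => [|x l IHl] /=; first by rewrite big_nil evl_nil.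
by rewrite evl_cat IHl big_cons.
Qed.

Lemma evl_bind F (G : seq nat -> R) r e : {in e, forall q, evl F (r q.2) = G q.2} ->
  evl F (bind_lin r e) = evl G e.
Proof.
move=> rE; rewrite evl_flatten; apply: eq_big_seq => q q_in.
by case: eqP => [->|_]; rewrite ?evl_nil ?mul0r // evl_scale rE.
Qed.

Lemma evl_int (F : seq nat -> R) G e : {in e, forall q, F q.2 = (G q.2)%:~R} ->
  evl F e = (evz G e)%:~R.
Proof.
elim: e => [|[c l] e IHe] FG; first by rewrite evl_nil.
rewrite evl_cons /= IHe => [|q q_in]; last by rewrite FG // inE q_in orbT.
rewrite (FG (c, l)) ?mem_head //=.
by case: eqP => [->|_]; rewrite ?mul0r ?add0r // intrD intrM.
Qed.

Lemma evnD k (a b : tensor R k) l : evn (a + b) l = evn a l + evn b l.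
Proof. by rewrite /evn /ev ffunE. Qed.

Lemma evnN k (a : tensor R k) l : evn (- a) l = - evn a l.
Proof. by rewrite /evn /ev ffunE. Qed.

Lemma evnZ k c (a : tensor R k) l : evn (c *: a) l = c * evn a l.
Proof. by rewrite /evn /ev ffunE. Qed.

Lemma evn_sum (J : Type) (r : seq J) k (a : J -> tensor R k) l :
  evn (\sum_(b <- r) a b) l = \sum_(b <- r) evn (a b) l.
Proof.
elim: r => [|b r IHr]; first by rewrite !big_nil /evn /ev ffunE.
by rewrite !big_cons evnD IHr.
Qed.

Lemma keys4P J : J \in keys 4 ->
  exists i j k l, [/\ J = [:: i; j; k; l], J \in lists 4 & size J = 4].
Proof.
move=> /keys_lists J_in.
have /andP[/eqP sz _] : (size J == 4) && all (gtn 8) J by rewrite -mem_lists.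
case: J sz J_in => [|i [|j [|k [|l [|? ?]]]]] // _ J_in.
by exists i, j, k, l.
Qed.

Lemma form4_eq (a b : tensor R 4) : is_form a -> is_form b ->
  (forall J, J \in keys 4 -> evn a J = evn b J) -> a = b.
Proof. exact: form_eq_keys sorts_to_keys4. Qed.

Lemma hodge_row_keys J q : q \in hodge_row J -> q.2 \in keys 4.
Proof. by case/mapP => K key_K ->. Qed.

Lemma evl_cancels4 s e : is_form s -> cancels 4 sort_sign e -> evl (evn s) e = 0.
Proof. by move=> form_s; apply: evl_cancels => l; exact: evn_sort. Qed.

Lemma hodge_hodge1 s : is_form s -> hodge4 1%:M (hodge4 1%:M s) = s.
Proof.
move=> form_s; apply: form4_eq => //; first exact: form_hodge.
move=> J key_J; rewrite hodge1_row //; last exact: form_hodge.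
move/allP: star_star_check => /(_ _ key_J) /(evl_cancels4 form_s).
rewrite evl_cons mulN1r addrC => /eqP; rewrite subr_eq0 => /eqP <-.
rewrite (@evl_bind _ (evn (hodge4 I8 s))) // => q /hodge_row_keys key_q.
by rewrite hodge1_row.
Qed.

Lemma hodge_phi1 : hodge4 1%:M Phi0 = Phi0.
Proof.
apply: form4_eq; [exact: form_hodge|exact: form_spin7|move=> J key_J].
rewrite hodge1_row //; last exact: form_spin7.
rewrite (evl_int (G := phiN)).
  by move/allP: star_phi_check => /(_ _ key_J) /eqP ->; rewrite evn_phi // keys_lists.
by move=> q /hodge_row_keys /keys_lists; exact: evn_phi.
Qed.

Definition beta (b : nat) : 'M[R]_8 := \matrix_(i, j) (betaN b.+1 [:: val i; val j])%:~R.

Lemma evn_beta b l : l \in lists 2 -> evn (tensor_of_mx (beta b)) l = (betaN b.+1 l)%:~R.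
Proof.
rewrite mem_lists; case: l => [|i [|j [|? ?]]] //= /and3P[lt_i lt_j _].
by rewrite /evn [map _ _]/= ev_mx mxE /= !inordK.
Qed.

Definition Dbeta b : tensor R 4 := Dop Phi0 1%:M (beta b).

Lemma form_Dbeta b : is_form (Dbeta b).
Proof. by apply: form_Dop; exact: form_spin7. Qed.

Lemma Dop_row_lists J q : J \in keys 4 -> q \in Dop_row_of J -> q.2 \in lists 2.
Proof.
case/keys4P => i [j [k [l [-> + _]]]]; rewrite !mem_lists => /and5P[_ lt_i lt_j lt_k].
move=> /andP[lt_l _]; rewrite /= in lt_i lt_j lt_k lt_l *.
rewrite !mem_cat => /or4P[] /mapP[m]; rewrite mem_iota => lt_m ->;
by rewrite /= ?lt_i ?lt_j ?lt_k ?lt_l; move: lt_m => /= ->.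
Qed.

Lemma evn_Dop_of (M : 'M[R]_8) J : J \in keys 4 ->
  evn (Dop Phi0 1%:M M) J = evl (evn (tensor_of_mx M)) (Dop_row_of J).
Proof. by case/keys4P => i [j [k [l [-> J_in _]]]]; rewrite evn_Dop. Qed.

Lemma evn_Dbeta b K : (b < 7)%N -> K \in keys 4 -> evn (Dbeta b) K = (DbetaN b K)%:~R.
Proof.
move=> lt_b key_K; rewrite evn_Dop_of // (evl_int (G := betaN b.+1)).
  have /allP/(_ b) := Dbeta_check; rewrite mem_iota => /(_ lt_b).
  by move=> /allP/(_ _ key_K)/eqP ->.
by move=> q /(Dop_row_lists key_K); exact: evn_beta.
Qed.

Lemma hodge_Dbeta1 b : (b < 7)%N -> hodge4 1%:M (Dbeta b) = Dbeta b.
Proof.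
move=> lt_b; apply: form4_eq; [exact: form_hodge|exact: form_Dbeta|move=> J key_J].
rewrite hodge1_row //; last exact: form_Dbeta.
rewrite (evl_int (G := DbetaN b)).
  have /allP/(_ _ key_J)/allP/(_ b) := star_Dbeta_check; rewrite mem_iota => /(_ lt_b)/eqP ->.
  by rewrite evn_Dbeta.
by move=> q /hodge_row_keys; exact: evn_Dbeta.
Qed.

Lemma form_inner_dotN (a b : tensor R 4) u v : is_form a -> is_form b ->
    {in keys 4, forall K, evn a K = (u K)%:~R} ->
    {in keys 4, forall K, evn b K = (v K)%:~R} ->
  form_inner 1%:M a b = (dotN u v)%:~R.
Proof.
move=> form_a form_b aE bE; rewrite form_inner1 //.
rewrite (eq_big_seq (fun K => (u K * v K)%:~R)); last first.
  by move=> K key_K; rewrite aE ?bE // intrM.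
rewrite /dotN; elim: (keys 4) => [|K l IHl]; first by rewrite big_nil.
by rewrite big_cons IHl /= intrD.
Qed.

Lemma evn_phi_keys : {in keys 4, forall K, evn Phi0 K = (phiN K)%:~R}.
Proof. by move=> K /keys_lists; exact: evn_phi. Qed.

Lemma inner_phi_phi1 : form_inner 1%:M Phi0 Phi0 = 14%:R.
Proof.
have form_Phi := form_spin7 I8.
rewrite (form_inner_dotN form_Phi form_Phi evn_phi_keys evn_phi_keys).
by case/and3P: inner_check => /eqP->.
Qed.

Lemma inner_phi_Dbeta1 b : (b < 7)%N -> form_inner 1%:M Phi0 (Dbeta b) = 0.
Proof.
move=> lt_b; rewrite (form_inner_dotN (form_spin7 I8) (form_Dbeta b) evn_phi_keys
  (fun K => evn_Dbeta lt_b)).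
case/and3P: inner_check => _ /allP/(_ b) + _.
by rewrite mem_iota => /(_ lt_b)/eqP->.
Qed.

Lemma inner_Dbeta_Dbeta1 a b : (a < 7)%N -> (b < 7)%N ->
  form_inner 1%:M (Dbeta a) (Dbeta b) = if a == b then 128%:R else 0.
Proof.
move=> lt_a lt_b; rewrite (form_inner_dotN (form_Dbeta a) (form_Dbeta b)
  (fun K => evn_Dbeta lt_a) (fun K => evn_Dbeta lt_b)).
case/and3P: inner_check => _ _ /allP/(_ a).
rewrite mem_iota => /(_ lt_a) /allP/(_ b); rewrite mem_iota => /(_ lt_b)/eqP->.
by case: eqP.
Qed.

Lemma evl_rank1 u (a : tensor R 4) s J : is_form a -> is_form s -> J \in keys 4 ->
    {in keys 4, forall K, evn a K = (u K)%:~R} ->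
  evl (evn s) (rank1_row u J) = form_inner 1%:M a s * evn a J.
Proof.
move=> form_a form_s key_J aE; rewrite form_inner1 // /rank1_row aE //.
case: eqP => [->|_]; first by rewrite evl_nil mulr0.
rewrite /evl big_map mulrC mulr_sumr; apply: eq_big_seq => K key_K /=.
by rewrite aE // intrM mulrA.
Qed.

Lemma Lambda1 s : is_form s ->
  8%:R *: Lambda Phi0 1%:M s = 16%:R *: (s + hodge4 1%:M s) -
    16%:R * form_inner 1%:M Phi0 s *: Phi0 -
    \sum_(b <- iota 0 7) form_inner 1%:M (Dbeta b) s *: Dbeta b.
Proof.
move=> form_s; have form_Phi := form_spin7 I8.
apply: form4_eq.
- by apply: is_formZ; exact: form_Lambda.
- apply: is_formD; first apply: is_formD.
  + by apply: is_formZ; apply: is_formD => //; exact: form_hodge.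
  + by apply: is_formN; apply: is_formZ.
  + apply: is_formN; apply: (big_ind (@is_form R 4)) => [t r|a b|b _].
    * by rewrite !ffunE mulr0.
    * exact: is_formD.
    * by apply: is_formZ; exact: form_Dbeta.
move=> J key_J; rewrite evnZ 2!evnD 2!evnN 2!evnZ evnD evn_sum.
have /allP/(_ _ key_J)/(evl_cancels4 form_s) := Lambda_check.
rewrite 4!evl_cat evl_flatten evl_cons evl_nil !evl_scale.
have [i [j [k [l [JE J_in _]]]]] := keys4P key_J.
have -> : evl (evn s) (Lambda_row_of J) = evn (Lambda Phi0 1%:M s) J.
  by rewrite JE evn_Lambda //; rewrite -JE.
rewrite -hodge1_row // (evl_rank1 form_Phi form_s key_J evn_phi_keys).
rewrite (eq_big_seq (fun b => evn (form_inner 1%:M (Dbeta b) s *: Dbeta b) J)) => [|b].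
  move=> sum0; apply/eqP; rewrite -subr_eq0 -[X in _ == X]sum0; apply/eqP.
  by rewrite /= !intrN; ring.
rewrite mem_iota => lt_b.
by rewrite evnZ (evl_rank1 (form_Dbeta b) form_s key_J (fun K => evn_Dbeta lt_b)).
Qed.
End StandardIdentities.

(** * The operator D in the standard frame *)

Section StandardDop.
Variable R : realType.
Implicit Types (s : tensor R 4) (e : linexp).
Notation ordn := (fun n : nat => inord n : 'I_8).
Notation I8 := (1%:M : 'M[R]_8).
Notation Phi0 := (spin7_form I8).

Lemma hodge_eigen_determined s (c : R) : is_form s -> hodge4 1%:M s = c *: s ->
  (forall K, K \in keys 4 -> 0%N \in K -> evn s K = 0) -> c != 0 -> s = 0.
Proof.
move=> form_s star_s s0 nz_c.
have form0 : is_form (0 : tensor R 4) by move=> t r; rewrite !ffunE mulr0.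
have evn0 J : evn (0 : tensor R 4) J = 0 by rewrite /evn /ev ffunE.
apply: form4_eq => // J key_J; rewrite evn0; apply: (mulfI nz_c).
rewrite mulr0 -evnZ -star_s hodge1_row //.
have /allP/(_ _ key_J)/orP[J0|/allP chk] := complement_check.
  by rewrite -hodge1_row // star_s evnZ s0 // mulr0.
rewrite /evl; apply: big1_seq => q /= q_in.
have /orP[/eqP->|q0] := chk _ q_in; first by rewrite mul0r.
by rewrite s0 ?mulr0 //; exact: hodge_row_keys q_in.
Qed.

Lemma form2_antisym (M : 'M[R]_8) : is_form (tensor_of_mx M) <-> M^T = - M.
Proof.
rewrite form_alternating; split=> [alt_M|antiM].
  apply/matrixP => i j; rewrite !mxE.
  by have := alt_M [::] i j [::] erefl; rewrite /= !ev_mx => ->; rewrite opprK.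
case=> [|z l1] x y l2; last by rewrite /= size_cat /= !addnS.
case: l2 => //= _.
by move/matrixP/(_ y x): antiM; rewrite !mxE !ev_mx => ->.
Qed.

Lemma Dop_antisym1 (M : 'M[R]_8) : M^T = - M ->
  exists c : nat -> R, 4%:R *: Dop Phi0 1%:M M = \sum_(b <- iota 0 7) c b *: Dbeta R b.
Proof.
move=> /form2_antisym form_M.
(* The pairings <beta_b, M>, not divided by the squared norm 4; hence the 4 on the left. *)
exists (fun b => \sum_(l <- keys 2) (betaN b.+1 l)%:~R * evn (tensor_of_mx M) l).
apply: form4_eq.
- by apply: is_formZ; apply: form_Dop; exact: form_spin7.
- apply: (big_ind (@is_form R 4)) => [t r|a b|b _].
  + by rewrite !ffunE mulr0.
  + exact: is_formD.
  + by apply: is_formZ; exact: form_Dbeta.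
move=> J key_J; rewrite evnZ evn_sum evn_Dop_of //.
have /allP/(_ _ key_J) chk := Dop_antisym_check.
have := evl_cancels (fun l sz => evn_sort form_M sz) chk.
rewrite evl_cat evl_scale evl_flatten intrN mulNr addrC => /eqP.
rewrite subr_eq0 => /eqP /esym chk0; apply: etrans chk0 _; apply: eq_big_seq => b.
rewrite mem_iota => lt_b; rewrite evnZ evn_Dbeta //; lazy zeta.
case: eqP => [->|_]; first by rewrite evl_nil mulr0.
rewrite /evl big_map mulrC mulr_sumr; apply: eq_bigr => l _.
by rewrite intrM mulrA.
Qed.

Lemma beta_antisym b : (b < 7)%N -> (beta R b)^T = - beta R b.
Proof.
move=> lt_b; apply/matrixP => i j; rewrite !mxE.
have /allP/(_ b) := beta_antisym_check; rewrite mem_iota => /(_ lt_b)/allP.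
move=> /(_ [:: val j; val i]); rewrite mem_lists /= !ltn_ord => /(_ isT)/eqP ->.
by rewrite intrN.
Qed.

(** By [hodge6_wedge] and the self-duality of Phi this is the star of Phi /\ b, in a form without
    6-tensors. *)
Definition phi_contract E (b : tensor R 2) : tensor R 2 :=
  [ffun t : 2.-tuple 'I_8 =>
    2^-1 * contraction (inv_metric E) 2 (ev b) (ev (spin7_form E)) [::] t].

Lemma ev_phi_contract E b l : size l = 2 -> ev (phi_contract E b) l =
  2^-1 * contraction (inv_metric E) 2 (ev b) (ev (spin7_form E)) [::] l.
Proof.
move=> sz; pose t := tcast sz (in_tuple l).
have -> : l = t by rewrite val_tcast.
by rewrite ev_tuple ffunE.
Qed.

Lemma phi_contract_beta1 b : (b < 7)%N ->
  phi_contract 1%:M (tensor_of_mx (beta R b)) = - 3%:R *: tensor_of_mx (beta R b).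
Proof.
move=> lt_b; apply: tensor_eq => l sz.
have evE (a : tensor R 2) : ev a l = evn a (map val l) by rewrite /evn mapK_ord.
rewrite [in RHS]evE evnZ ev_phi_contract // inv_metric1.
have l_in := val_lists sz.
rewrite evn_beta // /contraction /dot ssum_lists.
have /allP/(_ b) := beta_eigen_check; rewrite mem_iota => /(_ lt_b)/allP/(_ _ l_in)/eqP chk.
rewrite (eq_big_seq (fun p => (betaN b.+1 p * phiN (p ++ map val l))%:~R)) => [|p p_in].
  transitivity (2^-1 * (- 6%:Z * betaN b.+1 (map val l))%:~R : R).
    rewrite -chk; congr (_ * _); elim: (lists 2) => [|p r IHr]; first by rewrite big_nil.
    by rewrite big_cons IHr /= intrD.
  by rewrite intrM intrN; field.
rewrite pbl1 -/(evn _ _) evn_beta // intrM -evn_phi; last first.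
  by move: p_in l_in; rewrite !mem_lists size_cat all_cat => /andP[/eqP-> ->] /andP[/eqP-> ->].
by rewrite /evn map_cat mapK_ord.
Qed.

Lemma Dop_sym1 (M : 'M[R]_8) : M^T = M ->
  hodge4 1%:M (Dop Phi0 1%:M M) = \tr M *: Phi0 - Dop Phi0 1%:M M.
Proof.
move=> symM; have form_Phi := form_spin7 I8.
have form_DM : is_form (Dop Phi0 I8 M) by exact: form_Dop.
apply: form4_eq; first exact: form_hodge.
  by apply: is_formD; [apply: is_formZ|apply: is_formN].
move=> J key_J; rewrite hodge1_row // evnD evnN evnZ evn_phi_keys // evn_Dop_of //.
have /allP/(_ _ key_J) chk := Dop_sym_check.
have := evl_cancels (F := evn (tensor_of_mx M)) _ chk.
rewrite evl_cat (@evl_cat _ _ (bind_lin _ _)).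
rewrite (@evl_bind _ _ (evn (Dop Phi0 I8 M))) => [|q /hodge_row_keys key_q]; last first.
  by rewrite evn_Dop_of.
have -> : evl (evn (tensor_of_mx M)) [seq (- phiN J, [:: m; m]) | m <- iota 0 8] =
    - (\tr M * (phiN J)%:~R).
  rewrite /evl big_map /mxtrace sum_iota mulr_suml -sumrN; apply: eq_bigr => m _.
  by rewrite /evn [map _ _]/= ev_mx intrN /= mulNr mulrC.
move=> chk0; apply/eqP; rewrite -subr_eq0; apply/eqP; rewrite -[RHS]chk0; first by ring.
case=> [|i [|j [|? ?]]] // _; rewrite /= mul1r.
case: ifP => // _; rewrite /evn [map _ _]/= [map _ _ in RHS]/= !ev_mx.
by rewrite -[in LHS]symM mxE.
Qed.

Lemma antiselfdual_Dop1 s : is_form s -> hodge4 1%:M s = - s ->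
  form_inner 1%:M Phi0 s = 0 ->
  exists M : 'M[R]_8, [/\ M^T = M, \tr M = 0 & s = Dop Phi0 1%:M M].
Proof.
move=> form_s star_s phi_s; have form_Phi := form_spin7 I8.
pose M : 'M[R]_8 := \matrix_(i, j) evl (evn s) (sym_row (val i) (val j)).
have symM : M^T = M.
  by apply/matrixP => i j; rewrite !mxE /sym_row !evl_cat addrC.
have trM : \tr M = 0.
  have := evl_cancels4 form_s trace_sym_row_check; rewrite evl_cat evl_flatten.
  have -> : evl (evn s) [seq (- 8%:Z * phiN K, K) | K <- keys 4] =
      - 8%:R * form_inner 1%:M Phi0 s.
    rewrite form_inner1 // /evl big_map mulr_sumr; apply: eq_big_seq => K key_K.
    by rewrite evn_phi_keys //= intrM intrN mulrA.
  rewrite phi_s mulr0 addr0 => tr0; rewrite /mxtrace sum_iota; apply: etrans tr0.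
  apply: eq_big_seq => m; rewrite mem_iota => lt_m.
  by rewrite mxE /= inordK.
(* [sym_row] followed by D multiplies anti-self-dual forms by 8. *)
exists (8%:R^-1 *: M); split.
- by rewrite linearZ /= symM.
- by rewrite mxtraceZ trM mulr0.
have Dop_scale c : Dop Phi0 I8 (c *: M) = c *: Dop Phi0 I8 M.
  have evZ (t : tensor R 4) l : ev (c *: t) l = c * ev t l by rewrite /ev ffunE.
  apply: tensor4_eq => i j k l; rewrite evZ !ev_fun4 mulr_sumr.
  apply: eq_bigr => m _; rewrite mulr_sumr; apply: eq_bigr => n _; rewrite !mxE; ring.
rewrite Dop_scale; apply: (scalerI (a := 8%:R)); first by rewrite pnatr_eq0.
rewrite scalerA mulfV ?pnatr_eq0 // scale1r.
apply: form4_eq; [exact: is_formZ|exact: form_Dop|move=> J key_J].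
rewrite evnZ evn_Dop_of //.
have /allP/(_ _ key_J)/(evl_cancels4 form_s) := Dop_sym_row_check.
rewrite evl_cat (evl_bind (G := evn (tensor_of_mx M))); last first.
  move=> q /(Dop_row_lists key_J); rewrite mem_lists.
  case: q => c [|i [|j [|? ?]]] //= /and3P[lt_i lt_j _].
  by rewrite /evn [map _ _]/= ev_mx mxE /= !inordK.
rewrite evl_cat evl_cat !evl_scale evl_cons evl_nil -hodge1_row //.
rewrite (evl_rank1 form_Phi form_s key_J (@evn_phi_keys R)) phi_s star_s evnN.
by move=> chk; apply/eqP; rewrite -subr_eq0; apply/eqP; rewrite -oppr0 -chk /= !intrN; ring.
Qed.

End StandardDop.

(** * Adapted frames *)

(** Exchanging two blocks of four indices is an even permutation. The symmetry of this matrix makes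
    the star self-adjoint. *)
Lemma volN_sym_check : all (fun J => all (fun K => volN (K ++ J) == volN (J ++ K))
  (keys 4)) (keys 4).
Proof. by vm_cast_no_check (erefl true). Qed.

Section AdaptedFrame.
Variables (R : realType) (E : 'M[R]_8).
Hypothesis uE : E \in unitmx.
Implicit Types (s t : tensor R 4).
Notation Phi := (spin7_form E).
Notation I8 := (1%:M : 'M[R]_8).
Notation Phi0 := (spin7_form I8).
Notation star := (hodge4 E).
Notation dotp := (form_inner E).

Let u1 : I8 \in unitmx. Proof. exact: unitmx1. Qed.

Lemma pullbackK k (a : tensor R k) : pullback E (pullback (invmx E) a) = a.
Proof. by rewrite pullback_comp mulVmx // pullback1. Qed.

Lemma spin7_form_pullback : Phi = pullback E Phi0.
Proof. by rewrite -spin7_formM mul1mx. Qed.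

Lemma hodge4_pullback s : star (pullback E s) = pullback E (hodge4 1%:M s).
Proof.
by have := hodge_pullback (erefl : (4 + 4 = 8)%N) s u1 uE; rewrite mul1mx.
Qed.

Lemma inner_pullback k (a b : tensor R k) :
  form_inner E (pullback E a) (pullback E b) = form_inner 1%:M a b.
Proof. by have := form_inner_pullback a b u1 uE; rewrite mul1mx. Qed.

(** Since [E] is invertible, every form is the pullback of one in the standard frame, where the
    identities have been computed. *)
Lemma frame_ind (P : tensor R 4 -> Prop) :
  (forall s, is_form s -> P (pullback E s)) -> forall s, is_form s -> P s.
Proof.
by move=> P_pull s form_s; rewrite -(pullbackK s); apply: P_pull; exact: form_pullback.
Qed.

Definition Dbeta_at (b : 'I_7) : tensor R 4 := pullback E (Dbeta R b).
Notation f7 := Dbeta_at.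

Lemma form_f7 b : is_form (f7 b).
Proof. by apply: form_pullback; exact: form_Dbeta. Qed.

Lemma hodge_hodge s : is_form s -> star (star s) = s.
Proof.
move: s; apply: frame_ind => s form_s.
by rewrite !hodge4_pullback hodge_hodge1.
Qed.

Lemma hodge_phi : star Phi = Phi.
Proof. by rewrite spin7_form_pullback hodge4_pullback hodge_phi1. Qed.

Lemma hodge_f7 b : star (f7 b) = f7 b.
Proof. by rewrite hodge4_pullback hodge_Dbeta1. Qed.

Lemma inner_phi_phi : dotp Phi Phi = 14%:R.
Proof. by rewrite spin7_form_pullback inner_pullback inner_phi_phi1. Qed.

Lemma inner_phi_f7 b : dotp Phi (f7 b) = 0.
Proof. by rewrite spin7_form_pullback inner_pullback inner_phi_Dbeta1. Qed.

Lemma inner_f7 a b : dotp (f7 a) (f7 b) = (128%:R *+ (a == b)).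
Proof. by rewrite inner_pullback inner_Dbeta_Dbeta1 // -val_eqE; case: eqP. Qed.

Lemma innerC s t : dotp s t = dotp t s.
Proof.
rewrite -(pullbackK s) -(pullbackK t) !inner_pullback !form_inner_contraction.
rewrite inv_metric1 trmx1 /contraction; congr (_ * _); apply: eq_ssum => u _.
by rewrite !pbl1 !cats0 mulrC.
Qed.

(** In the standard frame the squared norm is 1/4! times a sum of squares of components. *)
Lemma inner_eq0 s : dotp s s = 0 -> s = 0.
Proof.
rewrite -(pullbackK s) inner_pullback; set t := pullback _ s => /eqP.
rewrite /form_inner mulf_eq0 invr_eq0 pnatr_eq0 /= psumr_eq0 => [/allP t0|r _].
  have -> : t = 0.
    apply/ffunP => r; have := t0 r (mem_index_enum _).
    rewrite ev_raise inv_metric1 trmx1 pbl1 ev_tuple /= mulf_eq0 orbb => /eqP ->.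
    by rewrite ffunE.
  by rewrite -[0](scale0r 0) pullbackZ !scale0r.
by rewrite ev_raise inv_metric1 trmx1 pbl1 ev_tuple -expr2 sqr_ge0.
Qed.

Lemma raise_linear k (c : R) (a b : tensor R k) r :
  raise E (c *: a + b) r = c * raise E a r + raise E b r.
Proof.
rewrite /raise mulr_sumr -big_split; apply: eq_bigr => q _ /=.
by rewrite !ffunE mulrDr mulrCA.
Qed.

Lemma inner_linear s : linear (dotp s : tensor R 4 -> R^o).
Proof.
move=> c a b; transitivity (c * dotp s a + dotp s b) => //.
rewrite /form_inner [c * _]mulrCA -mulrDr [c * \sum_(_ <- _) _]mulr_sumr -big_split.
congr (_ * _).
by apply: eq_bigr => r _; rewrite !ffunE mulrDr mulrCA.
Qed.

Lemma hodge4_linear : linear star.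
Proof.
move=> c a b; apply/ffunP => r.
transitivity (c * star a r + star b r); last by rewrite !ffunE.
rewrite !ffunE [c * _]mulrCA -mulrDr [c * \sum_(_ <- _) _]mulr_sumr -big_split; congr (_ * _).
by apply: eq_bigr => q _; rewrite raise_linear mulrDl mulrA.
Qed.

HB.instance Definition _ s :=
  GRing.isLinear.Build R (tensor R 4) R^o *:%R (dotp s) (inner_linear s).
HB.instance Definition _ :=
  GRing.isLinear.Build R (tensor R 4) (tensor R 4) *:%R star hodge4_linear.

Lemma inner_hodge s t : is_form s -> is_form t -> dotp (star s) t = dotp s (star t).
Proof.
move=> form_s; move: t; apply: frame_ind => t form_t; move: s form_s.
apply: frame_ind => s form_s; rewrite !hodge4_pullback !inner_pullback.
rewrite !form_inner1 //; try exact: form_hodge.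
transitivity (\sum_(J <- keys 4) \sum_(K <- keys 4)
   (volN (K ++ J))%:~R * (evn s K * evn t J)).
  apply: eq_big_seq => J key_J; rewrite hodge1_row // /evl big_map mulr_suml.
  by apply: eq_bigr => K _; rewrite mulrA.
rewrite exchange_big /=; apply: eq_big_seq => K key_K.
rewrite hodge1_row // /evl big_map mulr_sumr; apply: eq_big_seq => J key_J /=.
by move/allP: volN_sym_check => /(_ _ key_J)/allP/(_ _ key_K)/eqP ->; rewrite mulrCA.
Qed.

Lemma Lambda_formula s : is_form s ->
  8%:R *: Lambda Phi E s = 16%:R *: (s + star s) - (16%:R * dotp Phi s) *: Phi -
    \sum_b dotp (f7 b) s *: f7 b.
Proof.
move: s; apply: frame_ind => s form_s.
have -> : Lambda Phi E (pullback E s) = pullback E (Lambda Phi0 1%:M s).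
  by rewrite -Lambda_pullback // mul1mx -spin7_form_pullback.
rewrite -pullbackZ Lambda1 // pullbackD pullbackD pullbackZ pullbackD -hodge4_pullback.
have pbN (a : tensor R 4) : pullback E (- a) = - pullback E a.
  by rewrite -scaleN1r pullbackZ scaleN1r.
rewrite !pbN pullbackZ -spin7_form_pullback [in RHS]spin7_form_pullback inner_pullback.
rewrite -spin7_form_pullback; congr (_ - _ - _).
rewrite -[iota 0 7]/(index_iota 0 7) big_mkord.
rewrite (big_morph (pullback E) (@pullbackD _ _ E) (_ : _ = 0)); last first.
  by rewrite -[0](scale0r 0) pullbackZ !scale0r.
by apply: eq_bigr => b _; rewrite pullbackZ -(inner_pullback (Dbeta R b)).
Qed.

Lemma hodge_eigen_coords s (c : R) : is_form s -> star s = c *: s -> c != 0 ->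
  (forall K, K \in [seq K <- keys 4 | 0%N \in K] -> evn (pullback (invmx E) s) K = 0) ->
  s = 0.
Proof.
move=> form_s star_s nz_c s0.
suff s'0 : pullback (invmx E) s = 0.
  by rewrite -(pullbackK s) s'0 -[0](scale0r 0) pullbackZ !scale0r.
apply: (hodge_eigen_determined (form_pullback _ form_s) _ _ nz_c) => [|K key_K K0].
  apply: (@can_inj _ _ (@pullback R 4 E) (pullback (invmx E))) => [a|].
    by rewrite pullback_comp mulmxV // pullback1.
  by rewrite -hodge4_pullback pullbackK star_s pullbackZ pullbackK.
by apply: s0; rewrite mem_filter K0 key_K.
Qed.

Lemma Dop_frame (M : 'M[R]_8) :
  Dop Phi E (E^T *m M *m E) = pullback E (Dop Phi0 1%:M M).
Proof.
rewrite -Dop_pullback //; last exact: form_spin7.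
by rewrite mul1mx -spin7_form_pullback.
Qed.

Lemma mx_frame (M : 'M[R]_8) : exists N, M = E^T *m N *m E.
Proof.
exists (invmx E^T *m M *m invmx E).
by rewrite !mulmxA mulmxV ?unitmx_tr // mul1mx mulmxKV.
Qed.

(** Since E g^{-1} E^T = 1, the metric trace of the transported matrix is an ordinary trace, by
    cyclicity. *)
Lemma tr_frame (M : 'M[R]_8) : \tr (inv_metric E *m (E^T *m M *m E)) = \tr M.
Proof.
have := inv_metricM u1 uE; rewrite mul1mx inv_metric1 => gE.
by rewrite !mulmxA mxtrace_mulC !mulmxA gE mul1mx.
Qed.

(** For the matrix c g each of the four terms of D returns c Phi. *)
Lemma Dop_metric c : Dop Phi E (c *: metric E) = (4%:R * c) *: Phi.
Proof.
have -> : c *: metric E = E^T *m (c *: 1%:M) *m E.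
  by rewrite -scalemxAr mulmx1 -scalemxAl.
rewrite Dop_frame spin7_form_pullback -pullbackZ; congr (pullback E _).
apply: tensor4_eq => i j k l; rewrite ev_fun4.
have -> : ev ((4%:R * c) *: Phi0) [:: i; j; k; l] = 4%:R * c * ev Phi0 [:: i; j; k; l].
  by rewrite /ev ffunE.
have delta (x : 'I_8) (G : 'I_8 -> R) :
    \sum_m \sum_n (c *: I8) x m * inv_metric I8 m n * G n = c * G x.
  rewrite (bigD1 x) //= [X in _ + X]big1 ?addr0 => [|m /negbTE ne]; last first.
    apply: big1 => n _; rewrite !mxE eq_sym ne mulr0 !mul0r //.
  rewrite (bigD1 x) //= big1 => [|n /negbTE ne].
    by rewrite inv_metric1 !mxE eqxx !mulr1 addr0.
  by rewrite inv_metric1 !mxE [x == n]eq_sym ne mulr0 mul0r.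
under eq_bigr => m _ do rewrite !big_split.
rewrite !big_split /= (delta i (fun n => comp4 Phi0 n j k l)).
rewrite (delta j (fun n => comp4 Phi0 i n k l)) (delta k (fun n => comp4 Phi0 i j n l)).
by rewrite (delta l (comp4 Phi0 i j k)) comp4E; ring.
Qed.

End AdaptedFrame.

(** * The operator D and the Spin(7) action in an adapted frame *)

Section AdaptedDop.
Variables (R : realType) (E : 'M[R]_8).
Hypothesis uE : E \in unitmx.
Implicit Types (s t : tensor R 4).
Notation Phi := (spin7_form E).
Notation I8 := (1%:M : 'M[R]_8).
Notation Phi0 := (spin7_form I8).
Notation star := (hodge4 E).
Notation dotp := (form_inner E).
Notation f7 := (Dbeta_at E).

Lemma pullback_sum_tensor k (J : finType) (a : J -> tensor R k) :
  pullback E (\sum_j a j) = \sum_j pullback E (a j).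
Proof.
apply: (big_morph (pullback E) (@pullbackD _ _ E)).
by rewrite -[0](scale0r 0) pullbackZ !scale0r.
Qed.

Lemma frame_transpose (M : 'M[R]_8) : (E^T *m M *m E)^T = E^T *m M^T *m E.
Proof. by rewrite !trmx_mul trmxK mulmxA. Qed.

Lemma frame_inj (M N : 'M[R]_8) : E^T *m M *m E = E^T *m N *m E -> M = N.
Proof.
by move/(can_inj (mulmxK uE)); apply: (can_inj (mulKmx _)); rewrite unitmx_tr.
Qed.

Lemma Dop_antisym (M : 'M[R]_8) : M^T = - M ->
  exists c, Dop Phi E M = \sum_b c b *: f7 b.
Proof.
have [N ->] := mx_frame uE M; rewrite frame_transpose -mulNmx -mulmxN => /frame_inj antiN.
have [c cE] := Dop_antisym1 antiN.
exists (fun b : 'I_7 => 4%:R^-1 * c b); rewrite Dop_frame //.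
apply: (scalerI (a := 4%:R)); first by rewrite pnatr_eq0.
rewrite -pullbackZ cE -[iota 0 7]/(index_iota 0 7) big_mkord pullback_sum_tensor.
rewrite scaler_sumr; apply: eq_bigr => b _.
by rewrite pullbackZ scalerA mulrA mulfV ?pnatr_eq0 // mul1r.
Qed.

Lemma phi_contract_pullback (b : tensor R 2) :
  phi_contract E (pullback E b) = pullback E (phi_contract 1%:M b).
Proof.
apply: tensor_eq => l sz; rewrite ev_pullback // ev_phi_contract //.
have := @contraction_pullback R I8 E 2 2 4 b Phi0 [::] l (unitmx1 _ _) uE erefl.
rewrite mul1mx sz -spin7_form_pullback // => -> //=.
by rewrite -pblZ; apply: eq_pbl => u; rewrite sz => sz_u; rewrite ev_phi_contract.
Qed.

Lemma phi_contract_linear (c : R) (a b : tensor R 2) :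
  phi_contract E (c *: a + b) = c *: phi_contract E a + phi_contract E b.
Proof.
apply: tensor_eq => l sz.
have evL (x y : tensor R 2) u : ev (c *: x + y) u = c * ev x u + ev y u by rewrite /ev !ffunE.
rewrite evL !ev_phi_contract // [c * _]mulrCA -mulrDr; congr (_ * _).
rewrite /contraction /dot -ssumZ -ssumD; apply: eq_ssum => u _.
by rewrite mulrA -mulrDl -pblZ -pblD; congr (_ * _); apply: eq_pbl => v _; rewrite evL.
Qed.

Lemma Omega2_7P (b : tensor R 2) :
  Omega2_7 Phi E b <-> is_form b /\ phi_contract E b = - 3%:R *: b.
Proof.
suff -> : phi_contract E b = hodge6 E (wedge Phi b) by [].
by apply: tensor_eq => l sz; rewrite hodge6_wedge // hodge_phi // ev_phi_contract.
Qed.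

Lemma tensor_of_mx_linear (c : R) (M N : 'M[R]_8) :
  tensor_of_mx (c *: M + N) = c *: tensor_of_mx M + tensor_of_mx N.
Proof. by apply/ffunP => t; rewrite !ffunE !mxE. Qed.

Lemma Dop_linear (c : R) (M N : 'M[R]_8) :
  Dop Phi E (c *: M + N) = c *: Dop Phi E M + Dop Phi E N.
Proof.
apply: tensor4_eq => i j k l.
have evL (x y : tensor R 4) u : ev (c *: x + y) u = c * ev x u + ev y u by rewrite /ev !ffunE.
rewrite evL !ev_fun4 mulr_sumr -big_split; apply: eq_bigr => m _.
rewrite mulr_sumr -big_split; apply: eq_bigr => n _ /=.
by rewrite !mxE; ring.
Qed.

Lemma span_f7_Dop (c : 'I_7 -> R) : exists M : 'M[R]_8,
  Omega2_7 Phi E (tensor_of_mx M) /\ \sum_b c b *: f7 b = Dop Phi E M.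
Proof.
(* No explicit matrix is assembled: the property [P] passes to sums and holds for each multiple of a
   transported [beta R b]. *)
pose P (M : 'M[R]_8) s := Omega2_7 Phi E (tensor_of_mx M) /\ s = Dop Phi E M.
have P0 : P 0 0.
  split; last first.
    apply: (addIr (Dop Phi E 0)).
    by rewrite add0r -[X in _ = X + _]scale1r -Dop_linear scale1r addr0.
  apply/Omega2_7P; have -> : tensor_of_mx (0 : 'M[R]_8) = 0.
    by apply/ffunP => t; rewrite !ffunE mxE.
  split; first by move=> s t; rewrite !ffunE mulr0.
  apply: (addIr (phi_contract E 0)).
  by rewrite scaler0 add0r -[X in X + _]scale1r -phi_contract_linear scale1r addr0.
suff [M [? ?]] : exists M, P M (\sum_b c b *: f7 b) by exists M.
apply: (big_ind (fun s => exists M, P M s)).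
- by exists 0.
- move=> _ _ [M [/Omega2_7P[form_M M7] ->]] [N [/Omega2_7P[form_N N7] ->]].
  (* The factor 1 puts the sum into the shape of the linearity lemmas. *)
  exists (1 *: M + N).
  split; last by rewrite Dop_linear scale1r.
  apply/Omega2_7P; rewrite tensor_of_mx_linear phi_contract_linear M7 N7.
  split; first by apply: is_formD => //; apply: is_formZ.
  by rewrite !scale1r scalerDr.
move=> b _; exists (c b *: (E^T *m beta R b *m E) + 0).
split; last by rewrite Dop_linear -(proj2 P0 : 0 = Dop Phi E 0) Dop_frame // addr0.
have [/Omega2_7P[form0 _] _] := P0.
apply/Omega2_7P; rewrite addr0 -[_ *: _]addr0 tensor_of_mx_linear phi_contract_linear.
have [/Omega2_7P[_ ->] _] := P0.
rewrite pullback_mx phi_contract_pullback phi_contract_beta1 // pullbackZ.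
split; last by rewrite scalerDr !scalerA [c b * _]mulrC.
apply: is_formD => //; apply: is_formZ; apply: form_pullback; apply/form2_antisym.
exact: beta_antisym.
Qed.

Lemma Dop_sym_antiselfdual (M : 'M[R]_8) : sym_traceless E M ->
  star (Dop Phi E M) = - Dop Phi E M.
Proof.
have [N ->] := mx_frame uE M; case; rewrite frame_transpose => /frame_inj symN.
rewrite tr_frame // => trN; rewrite Dop_frame // hodge4_pullback // Dop_sym1 // trN.
by rewrite scale0r add0r -scaleN1r pullbackZ scaleN1r.
Qed.

Lemma antiselfdual_Dop s : is_form s -> star s = - s ->
  exists M, sym_traceless E M /\ s = Dop Phi E M.
Proof.
move: s; apply: (frame_ind uE) => s form_s; rewrite hodge4_pullback // => star_s.
have {}star_s : hodge4 1%:M s = - s.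
  apply: (@can_inj _ _ (@pullback R 4 E) (pullback (invmx E))) => [a|].
    by rewrite pullback_comp mulmxV // pullback1.
  by rewrite star_s -[in RHS]scaleN1r pullbackZ scaleN1r.
(* Self-adjointness gives <Phi, s> = <star Phi, s> = <Phi, star s> = - <Phi, s>. *)
have phi_s : form_inner 1%:M Phi0 s = 0.
  have /eqP := inner_hodge (unitmx1 _ _) (form_spin7 I8) form_s.
  rewrite (hodge_phi (unitmx1 _ _)) star_s linearN /= -addr_eq0 -mulr2n mulrn_eq0.
  by move/eqP.
have [N [symN trN ->]] := antiselfdual_Dop1 form_s star_s phi_s.
exists (E^T *m N *m E); split; last by rewrite Dop_frame.
by split; rewrite ?frame_transpose ?symN ?tr_frame.
Qed.

Section Spin7Action.
Variable A : 'M[R]_8.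
Hypothesis A_spin7 : in_Spin7 Phi E A.

Lemma spin7_unit : A \in unitmx.
Proof. by case: A_spin7 => -[_ detA] _; rewrite unitmxE detA unitr1. Qed.

(** An [A] in Spin(7) replaces the frame [E] by [E *m A], which has the same metric and, by the next
    lemma, the same volume form; naturality under pullback thus becomes equivariance. *)
Lemma inv_metric_spin7 : inv_metric (E *m A) = inv_metric E.
Proof. by case: A_spin7 => -[gA _] _; rewrite /inv_metric metricM gA. Qed.

Lemma volume_spin7 : volume (E *m A) = volume E.
Proof.
case: A_spin7 => -[_ detA] _.
by rewrite volume_det det_mulmx detA mulr1 -volume_det.
Qed.

Lemma inner_spin7 s t : dotp (pullback A s) (pullback A t) = dotp s t.
Proof.
rewrite -[RHS](form_inner_pullback s t uE spin7_unit).
by rewrite /form_inner /raise inv_metric_spin7.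
Qed.

Lemma hodge_spin7 s : star (pullback A s) = pullback A (star s).
Proof.
rewrite -[RHS](hodge_pullback (erefl : (4 + 4 = 8)%N) s uE spin7_unit).
by rewrite /hodge4 /hodge /raise inv_metric_spin7 volume_spin7.
Qed.

Lemma Lambda_spin7 s : Lambda Phi E (pullback A s) = pullback A (Lambda Phi E s).
Proof.
rewrite -(Lambda_pullback Phi s uE spin7_unit); case: A_spin7 => _ ->.
by rewrite /Lambda /contract2 inv_metric_spin7.
Qed.
End Spin7Action.

End AdaptedDop.

(** * Eigenspaces *)

Section Decomposition.
Variables (R : realType) (E : 'M[R]_8).
Hypothesis uE : E \in unitmx.
Implicit Types (s t : tensor R 4) (U W : {vspace tensor R 4}).
Notation Phi := (spin7_form E).
Notation star := (hodge4 E).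
Notation dotp := (form_inner E).
Notation f7 := (Dbeta_at E).
Notation Lam := (Lambda Phi E).

Definition keys0 := [seq K <- keys 4 | 0%N \in K].

(** There are 35 increasing lists of length 4 through 0, three further indices out of seven. By
    [hodge_eigen_coords] these components separate the eigenforms of the star, which bounds its
    eigenspaces. *)
Definition coords0 s : 'rV[R]_35 :=
  \row_i evn (pullback (invmx E) s) (nth [::] keys0 i).

Lemma coords0_linear : linear coords0.
Proof.
move=> c a b; apply/rowP => i; rewrite !mxE.
by rewrite pullbackD pullbackZ evnD evnZ.
Qed.
HB.instance Definition _ :=
  GRing.isLinear.Build R (tensor R 4) 'rV[R]_35 *:%R coords0 coords0_linear.

Lemma size_keys0 : size keys0 = 35.
Proof. by vm_cast_no_check (erefl 35%N). Qed.

Lemma dim_hodge_eigen U (c : R) : c != 0 ->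
  (forall s, s \in U -> is_form s /\ star s = c *: s) -> (\dim U <= 35)%N.
Proof.
move=> nz_c eigU.
have ker0 : (U :&: lker (linfun coords0) = 0)%VS.
  apply/eqP; rewrite -subv0; apply/subvP => s; rewrite memv_cap memv_ker memv0.
  case/andP => /eigU[form_s star_s] /eqP; rewrite lfunE /= => /rowP s0; apply/eqP.
  apply: (hodge_eigen_coords uE form_s star_s nz_c) => K /(nthP [::])[i lt_i <-].
  rewrite -/keys0 size_keys0 in lt_i.
  by have := s0 (Ordinal lt_i); rewrite !mxE.
rewrite -(limg_dim_eq ker0) (leq_trans (dimvS (subvf _))) //.
by rewrite dimvf dim_matrix.
Qed.

Lemma innerZ s c t : dotp s (c *: t) = c * dotp s t.
Proof. by rewrite linearZ. Qed.

Lemma innerD s t u : dotp s (t + u) = dotp s t + dotp s u.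
Proof. by rewrite linearD. Qed.

Lemma inner0 s : dotp s 0 = 0.
Proof. by rewrite linear0. Qed.

Lemma inner_sum_f7 s (c : 'I_7 -> R) :
  dotp s (\sum_b c b *: f7 b) = \sum_b c b * dotp s (f7 b).
Proof. by rewrite linear_sum; apply: eq_bigr => b _; rewrite linearZ. Qed.

Lemma inner_f7_sum a (c : 'I_7 -> R) : dotp (f7 a) (\sum_b c b *: f7 b) = 128%:R * c a.
Proof.
rewrite inner_sum_f7 (bigD1 a) //= big1 ?addr0 => [|b /negbTE ne].
  by rewrite inner_f7 // eqxx mulrC.
by rewrite inner_f7 // eq_sym ne mulr0.
Qed.

Lemma inner_phi_sum (c : 'I_7 -> R) : dotp Phi (\sum_b c b *: f7 b) = 0.
Proof. by rewrite inner_sum_f7 big1 // => b _; rewrite inner_phi_f7 // mulr0. Qed.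

Lemma form_sum_f7 (c : 'I_7 -> R) : is_form (\sum_b c b *: f7 b).
Proof.
apply: (big_ind (@is_form R 4)) => [t r|a b|b _].
- by rewrite !ffunE mulr0.
- exact: is_formD.
- by apply: is_formZ; exact: form_f7.
Qed.

Lemma hodge_sum_f7 (c : 'I_7 -> R) : star (\sum_b c b *: f7 b) = \sum_b c b *: f7 b.
Proof. by rewrite linear_sum; apply: eq_bigr => b _; rewrite linearZ /= hodge_f7. Qed.

Lemma inner_selfdual_antiselfdual s t : is_form s -> is_form t ->
  star s = s -> star t = - t -> dotp s t = 0.
Proof.
move=> form_s form_t star_s star_t; have /eqP := inner_hodge uE form_s form_t.
by rewrite star_s star_t linearN /= -addr_eq0 -mulr2n mulrn_eq0 => /eqP.
Qed.

Definition proj_1 s : tensor R 4 := (14%:R^-1 * dotp Phi s) *: Phi.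
Definition proj_7 s : tensor R 4 := \sum_b (128%:R^-1 * dotp (f7 b) s) *: f7 b.
Definition proj_35 s : tensor R 4 := 2^-1 *: (s - star s).
Lemma proj1_linear : linear proj_1.
Proof.
move=> c a b; rewrite /proj_1 linearP scalerA -scalerDl; congr (_ *: _).
by rewrite mulrDr mulrCA.
Qed.
HB.instance Definition _ :=
  GRing.isLinear.Build R (tensor R 4) (tensor R 4) *:%R proj_1 proj1_linear.

Lemma proj7_linear : linear proj_7.
Proof.
move=> c a b; rewrite /proj_7 scaler_sumr -big_split; apply: eq_bigr => i _ /=.
by rewrite linearP scalerA -scalerDl mulrDr mulrCA.
Qed.
HB.instance Definition _ :=
  GRing.isLinear.Build R (tensor R 4) (tensor R 4) *:%R proj_7 proj7_linear.

Lemma proj35_linear : linear proj_35.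
Proof.
move=> c a b; rewrite /proj_35 linearP /= scalerA mulrC -scalerA -scalerDr.
by congr (_ *: _); rewrite scalerBr opprD addrACA.
Qed.
HB.instance Definition _ :=
  GRing.isLinear.Build R (tensor R 4) (tensor R 4) *:%R proj_35 proj35_linear.

(** Defined as the remainder, which spares a basis of the 27-dimensional space; its values are
    described by self-duality and orthogonality instead. *)
Definition proj_27 : 'End(tensor R 4) :=
  (\1 - linfun proj_1 - linfun proj_7 - linfun proj_35)%VF.

Lemma proj27E s : proj_27 s = s - proj_1 s - proj_7 s - proj_35 s.
Proof. by rewrite !(add_lfunE, opp_lfunE) id_lfunE !lfunE. Qed.

Lemma proj_sum s : s = proj_1 s + proj_7 s + proj_27 s + proj_35 s.
Proof. by rewrite proj27E -addrA subrK -[s - _ - _]addrA -opprD addrC subrK. Qed.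

Lemma form_proj35 s : is_form s -> is_form (proj_35 s).
Proof.
by move=> form_s; apply: is_formZ; apply: is_formD => //; apply: is_formN; exact: form_hodge.
Qed.

Lemma form_proj27 s : is_form s -> is_form (proj_27 s).
Proof.
move=> form_s; rewrite proj27E.
apply: is_formD; last by apply: is_formN; exact: form_proj35.
apply: is_formD; last by apply: is_formN; exact: form_sum_f7.
by apply: is_formD => //; apply: is_formN; apply: is_formZ; exact: form_spin7.
Qed.

Lemma hodge_proj35 s : is_form s -> star (proj_35 s) = - proj_35 s.
Proof.
move=> form_s; rewrite linearZ linearB /= hodge_hodge // -scalerN opprB //.
Qed.

Lemma hodge_proj27 s : is_form s -> star (proj_27 s) = proj_27 s.
Proof.
move=> form_s.
have starE : star s = s - proj_35 s - proj_35 s.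
  rewrite -addrA -opprD -mulr2n /proj_35 -scaler_nat scalerA mulfV ?pnatr_eq0 //.
  by rewrite scale1r subKr.
rewrite proj27E !linearB /= hodge_proj35 // linearZ /= hodge_phi // -/(proj_1 s).
rewrite hodge_sum_f7 -/(proj_7 s) starE opprK.
rewrite (addrAC _ (- proj_7 s)) (addrAC _ (- proj_1 s)) subrK.
by rewrite (addrAC s) (addrAC (s - proj_1 s)).
Qed.

Lemma inner_phi_proj27 s : is_form s -> dotp Phi (proj_27 s) = 0.
Proof.
move=> form_s; rewrite proj27E !linearB /= inner_phi_sum subr0.
rewrite (@inner_selfdual_antiselfdual Phi (proj_35 s)) ?hodge_phi ?hodge_proj35 //.
- by rewrite subr0 innerZ inner_phi_phi // mulrC mulrA mulfV ?pnatr_eq0 // mul1r subrr.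
- exact: form_spin7.
- exact: form_proj35.
Qed.

Lemma inner_f7_proj27 b s : is_form s -> dotp (f7 b) (proj_27 s) = 0.
Proof.
move=> form_s; rewrite proj27E !linearB /= inner_f7_sum mulrA mulfV ?pnatr_eq0 // mul1r.
rewrite (@inner_selfdual_antiselfdual (f7 b) (proj_35 s)) ?hodge_f7 ?hodge_proj35 //.
- by rewrite subr0 innerZ (innerC uE _ Phi) inner_phi_f7 // mulr0 subr0 subrr.
- exact: form_f7.
- exact: form_proj35.
Qed.

(** On self-dual forms the first term is 4 s; the weights 28 and 16 lower the eigenvalue to 4 - 28 =
    -24 on Phi and to 4 - 16 = -12 on the D(beta_b). *)
Lemma Lambda_proj s : is_form s ->
  Lam s = 2%:R *: (s + star s) - (28%:R *: proj_1 s) - 16%:R *: proj_7 s.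
Proof.
move=> form_s; apply: (scalerI (a := 8%:R)); first by rewrite pnatr_eq0.
rewrite Lambda_formula // 2!scalerBr 3!scalerA scalerA.
have -> : 8%:R * 28%:R * (14%:R^-1 * dotp Phi s) = 16%:R * dotp Phi s by field.
rewrite -!natrM; congr (_ - _ - _); rewrite scaler_sumr; apply: eq_bigr => b _.
by rewrite scalerA mulrA mulfV ?mul1r ?pnatr_eq0.
Qed.

Definition basis8 : 8.-tuple (tensor R 4) := [tuple of Phi :: [tuple f7 b | b < 7]].

Lemma basis8_sum (k : 'I_8 -> R) :
  \sum_(i < 8) k i *: basis8`_i = k ord0 *: Phi + \sum_(b < 7) k (lift ord0 b) *: f7 b.
Proof.
rewrite big_ord_recl; congr (_ + _); apply: eq_bigr => b _; congr (_ *: _).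
by rewrite lift0 /= nth_mktuple.
Qed.

Lemma dim_basis8 : \dim <<basis8>> = 8%N.
Proof.
suff /eqP -> : free basis8 by rewrite size_tuple.
apply/(@freeP _ _ _ basis8) => k; rewrite basis8_sum => k0 i.
have kb b : k (lift ord0 b) = 0.
  have := congr1 (dotp (f7 b)) k0.
  rewrite innerD innerZ inner0 (innerC uE _ Phi) inner_phi_f7 // mulr0 add0r.
  rewrite inner_f7_sum => /eqP; rewrite mulf_eq0 pnatr_eq0 /= => /eqP; exact.
case: (unliftP ord0 i) => [b ->|->]; first exact: kb.
have := congr1 (dotp Phi) k0; rewrite innerD innerZ inner0 inner_phi_phi //.
by rewrite inner_phi_sum addr0 => /eqP; rewrite mulf_eq0 pnatr_eq0 orbF => /eqP.
Qed.

(** The span of [basis8] is self-dual too, and it meets [U] in 0 since a common element is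
    orthogonal to itself; the direct sum still obeys the bound 35. *)
Lemma dim_orthogonal_selfdual U :
    (forall s, s \in U -> [/\ is_form s, star s = s, dotp Phi s = 0 &
      forall b, dotp (f7 b) s = 0]) ->
  (\dim U <= 27)%N.
Proof.
move=> UP.
have span8 s : s \in <<basis8>>%VS ->
    exists k, s = k ord0 *: Phi + \sum_(b < 7) k (lift ord0 b) *: f7 b.
  by move/coord_span => ->; exists (fun i => coord basis8 i s); rewrite basis8_sum.
have cap0 : (U :&: <<basis8>> = 0)%VS.
  apply/eqP; rewrite -subv0; apply/subvP => s; rewrite memv_cap memv0.
  case/andP => /UP[_ _ phi_s f7_s] /span8[k sE]; apply/eqP; apply: (inner_eq0 uE).
  rewrite [X in dotp _ X]sE innerD innerZ innerC // phi_s mulr0 add0r.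
  by rewrite inner_sum_f7 big1 // => b _; rewrite innerC // f7_s mulr0.
suff : (\dim (U + <<basis8>>) <= 35)%N.
  by rewrite (dimv_disjoint_sum cap0) dim_basis8 -[35%N]/(27 + 8)%N leq_add2r.
apply: (@dim_hodge_eigen _ 1) => [|s]; first exact: oner_neq0.
case/memv_addP => u /UP[form_u star_u _ _] [w /span8[k ->] ->]; rewrite scale1r.
split; last by rewrite !linearD /= linearZ /= star_u hodge_phi // hodge_sum_f7.
apply: is_formD => //; apply: is_formD; first by apply: is_formZ; exact: form_spin7.
exact: form_sum_f7.
Qed.


(** Pairing [Lambda_formula] with Phi gives 8 c x = (32 - 224) x for x = <Phi, s>; so an eigenform
    for any eigenvalue other than -24 is orthogonal to Phi. *)
Lemma eigen_inner_phi s (c : R) : is_form s -> Lam s = c *: s ->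
  (c + 24%:R) * dotp Phi s = 0.
Proof.
move=> form_s eig; have := congr1 (dotp Phi) (Lambda_formula uE form_s).
rewrite eig !(innerD, innerZ) -scaleN1r innerZ -[- \sum_b _]scaleN1r innerZ innerZ.
rewrite inner_phi_sum inner_phi_phi //.
have -> : dotp Phi (star s) = dotp Phi s.
  by rewrite -inner_hodge ?hodge_phi //; exact: form_spin7.
move=> H; apply: (mulfI (_ : 8%:R != 0)); first by rewrite pnatr_eq0.
have -> : 8%:R * ((c + 24%:R) * dotp Phi s) =
  8%:R * (c * dotp Phi s) + 192%:R * dotp Phi s by ring.
by rewrite H; ring.
Qed.

Lemma eigen_inner_f7 b s (c : R) : is_form s -> Lam s = c *: s ->
  (c + 12%:R) * dotp (f7 b) s = 0.
Proof.
move=> form_s eig; have := congr1 (dotp (f7 b)) (Lambda_formula uE form_s).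
rewrite eig !(innerD, innerZ) -scaleN1r innerZ -[- \sum_b _]scaleN1r innerZ innerZ.
rewrite inner_f7_sum (innerC uE _ Phi) inner_phi_f7 //.
have -> : dotp (f7 b) (star s) = dotp (f7 b) s.
  by rewrite -inner_hodge ?hodge_f7 //; exact: form_f7.
move=> H; apply: (mulfI (_ : 8%:R != 0)); first by rewrite pnatr_eq0.
have -> : 8%:R * ((c + 12%:R) * dotp (f7 b) s) =
  8%:R * (c * dotp (f7 b) s) + 96%:R * dotp (f7 b) s by ring.
by rewrite H; ring.
Qed.

Lemma proj1_phi c : proj_1 (c *: Phi) = c *: Phi.
Proof. by rewrite /proj_1 innerZ inner_phi_phi // mulrC mulfK ?pnatr_eq0. Qed.

Lemma proj7_sum c : proj_7 (\sum_b c b *: f7 b) = \sum_b c b *: f7 b.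
Proof.
apply: eq_bigr => b _; rewrite inner_f7_sum mulrA mulVf ?mul1r ?pnatr_eq0 //.
Qed.

Lemma proj7_phi c : proj_7 (c *: Phi) = 0.
Proof.
apply: big1 => b _; rewrite innerZ (innerC uE _ Phi) inner_phi_f7 //.
by rewrite !mulr0 scale0r.
Qed.

Lemma proj1_sum c : proj_1 (\sum_b c b *: f7 b) = 0.
Proof. by rewrite /proj_1 inner_phi_sum mulr0 scale0r. Qed.

(** Every term of [Lambda_proj] is fixed by the star. Consequently eigenforms of nonzero eigenvalue
    are self-dual. *)
Lemma hodge_Lambda s : is_form s -> star (Lam s) = Lam s.
Proof.
move=> form_s; rewrite Lambda_proj //.
have : star (proj_1 s) = proj_1 s by rewrite linearZ /= hodge_phi.
have : star (proj_7 s) = proj_7 s by exact: hodge_sum_f7.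
move: (proj_1 s) (proj_7 s) => p q star_q star_p.
by rewrite !linearB /= !linearZ /= linearD /= hodge_hodge // star_p star_q [star s + s]addrC.
Qed.

Lemma eigen_selfdual s (c : R) : is_form s -> Lam s = c *: s -> c != 0 -> star s = s.
Proof.
move=> form_s eig nz_c; apply: (scalerI nz_c).
by rewrite -linearZ /= -eig hodge_Lambda.
Qed.

Lemma eigen_phi0 s (c : R) : is_form s -> Lam s = c *: s -> c + 24%:R != 0 -> dotp Phi s = 0.
Proof.
move=> form_s eig /negbTE nz; have /eqP := eigen_inner_phi form_s eig.
by rewrite mulf_eq0 nz => /eqP.
Qed.

Lemma eigen_f70 s (c : R) : is_form s -> Lam s = c *: s -> c + 12%:R != 0 ->
  forall b, dotp (f7 b) s = 0.
Proof.
move=> form_s eig /negbTE nz b; have /eqP := eigen_inner_f7 b form_s eig.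
by rewrite mulf_eq0 nz => /eqP.
Qed.

Lemma proj1_eq0 s : dotp Phi s = 0 -> proj_1 s = 0.
Proof. by rewrite /proj_1 => ->; rewrite mulr0 scale0r. Qed.

Lemma proj7_eq0 s : (forall b, dotp (f7 b) s = 0) -> proj_7 s = 0.
Proof. by move=> f0; apply: big1 => b _; rewrite f0 mulr0 scale0r. Qed.

Lemma eigenspace1 s : (is_form s /\ Lam s = - 24%:R *: s) <-> exists c, s = c *: Phi.
Proof.
split=> [[form_s eig]|[c ->]]; last first.
  split; first by apply: is_formZ; exact: form_spin7.
  rewrite Lambda_proj; last by apply: is_formZ; exact: form_spin7.
  rewrite proj1_phi proj7_phi linearZ /= hodge_phi // scaler0 subr0 -mulr2n.
  rewrite -scaler_nat !scalerA -scalerBl; congr (_ *: _); ring.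
have nz24 : - 24%:R != 0 :> R by rewrite oppr_eq0 pnatr_eq0.
have nz : - 24%:R + 12%:R != 0 :> R.
  by rewrite addrC subr_eq0 eqr_nat.
have p7 := proj7_eq0 (eigen_f70 form_s eig nz).
exists (14%:R^-1 * dotp Phi s); rewrite -/(proj_1 s).
have := Lambda_proj form_s; rewrite eig (eigen_selfdual form_s eig nz24) p7 scaler0 subr0.
rewrite -mulr2n -[s *+ 2]scaler_nat scalerA => LE.
(* Now - 24 s = 4 s - 28 P_1 s, that is, 28 s = 28 P_1 s. *)
apply: (scalerI (a := 28%:R)); first by rewrite pnatr_eq0.
rewrite -[RHS](subKr ((2%:R * 2%:R) *: s)) -LE -scalerBl; congr (_ *: _); ring.
Qed.

Lemma eigenspace7 s : (is_form s /\ Lam s = - 12%:R *: s) <->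
  exists c, s = \sum_b c b *: f7 b.
Proof.
split=> [[form_s eig]|[c ->]]; last first.
  split; first exact: form_sum_f7.
  rewrite Lambda_proj; last exact: form_sum_f7.
  rewrite proj1_sum proj7_sum hodge_sum_f7 scaler0 subr0 -mulr2n.
  rewrite -scaler_nat !scalerA -scalerBl; congr (_ *: _); ring.
have nz12 : - 12%:R != 0 :> R by rewrite oppr_eq0 pnatr_eq0.
have nz : - 12%:R + 24%:R != 0 :> R by rewrite addrC subr_eq0 eqr_nat.
have p1 := proj1_eq0 (eigen_phi0 form_s eig nz).
exists (fun b => 128%:R^-1 * dotp (f7 b) s); rewrite -/(proj_7 s).
have := Lambda_proj form_s; rewrite eig (eigen_selfdual form_s eig nz12) p1 scaler0 subr0.
rewrite -mulr2n -[s *+ 2]scaler_nat scalerA => LE.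
(* Likewise - 12 s = 4 s - 16 P_7 s. *)
apply: (scalerI (a := 16%:R)); first by rewrite pnatr_eq0.
rewrite -[RHS](subKr ((2%:R * 2%:R) *: s)) -LE -scalerBl; congr (_ *: _); ring.
Qed.

Lemma eigenspace27 s : (is_form s /\ Lam s = 4%:R *: s) <->
  [/\ is_form s, star s = s, dotp Phi s = 0 & forall b, dotp (f7 b) s = 0].
Proof.
split=> [[form_s eig]|[form_s star_s phi_s f7_s]]; last first.
  split=> //; rewrite Lambda_proj // proj1_eq0 // proj7_eq0 // !scaler0 !subr0 star_s.
  by rewrite -mulr2n -scaler_nat scalerA -natrM.
split=> //.
- by apply: (eigen_selfdual form_s eig); rewrite pnatr_eq0.
- by apply: (eigen_phi0 form_s eig); rewrite -natrD pnatr_eq0.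
- by apply: (eigen_f70 form_s eig); rewrite -natrD pnatr_eq0.
Qed.

Lemma eigenspace35 s : (is_form s /\ Lam s = 0) <-> is_form s /\ star s = - s.
Proof.
split=> -[form_s].
  rewrite -(scale0r s) => eig; split=> //.
  (* The eigenvalue 0 is neither -24 nor -12, so both projections vanish and 0 = 2 (s + star s)
     remains. *)
  have phi_s := eigen_phi0 form_s eig; have f7_s := eigen_f70 form_s eig.
  have := Lambda_proj form_s; rewrite eig proj1_eq0 ?proj7_eq0 //; last first.
  + by apply: phi_s; rewrite add0r pnatr_eq0.
  + by apply: f7_s; rewrite add0r pnatr_eq0.
  rewrite scale0r !scaler0 !subr0 => /eqP; rewrite eq_sym scaler_eq0 pnatr_eq0 /=.
  by rewrite addrC addr_eq0 => /eqP.
move=> star_s; split=> //; rewrite Lambda_proj // star_s subrr scaler0 sub0r.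
have form_Phi := form_spin7 E.
rewrite proj1_eq0; last by apply: inner_selfdual_antiselfdual => //; exact: hodge_phi.
rewrite proj7_eq0 => [|b]; first by rewrite !scaler0 !oppr0 addr0.
by apply: inner_selfdual_antiselfdual => //; [exact: form_f7|exact: hodge_f7].
Qed.

End Decomposition.

(** * Identification of the irreducible summands *)

Section Irreducibles.
Variables (R : realType) (E : 'M[R]_8).
Hypothesis uE : E \in unitmx.
Implicit Types (s t : tensor R 4) (U W : {vspace tensor R 4}).
Notation Phi := (spin7_form E).
Notation star := (hodge4 E).
Notation dotp := (form_inner E).
Notation f7 := (Dbeta_at E).
Notation proj1 := (proj_1 E).
Notation proj7 := (proj_7 E).
Notation proj27 := (proj_27 E).
Notation proj35 := (proj_35 E).

Lemma pullbackN A s : pullback A (- s) = - pullback A s.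
Proof. by rewrite -scaleN1r pullbackZ scaleN1r. Qed.

Lemma pullback0 A : pullback A 0 = 0 :> tensor R 4.
Proof. by rewrite -[0](scale0r 0) pullbackZ !scale0r. Qed.

Lemma proj1_spin7 A s : in_Spin7 Phi E A -> proj1 (pullback A s) = pullback A (proj1 s).
Proof.
move=> spinA; have [_ phiA] := spinA.
by rewrite pullbackZ phiA /proj1 -{1}phiA (inner_spin7 uE spinA).
Qed.

Lemma proj35_spin7 A s : in_Spin7 Phi E A -> proj35 (pullback A s) = pullback A (proj35 s).
Proof.
by move=> spinA; rewrite pullbackZ pullbackD pullbackN -(hodge_spin7 uE spinA).
Qed.

(** The individual D(beta_b) are not invariant, so the projection is solved for in [Lambda_proj], as
    a combination of the identity, the star, [proj1] and Lambda, all of them equivariant. *)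
Lemma proj7_spin7 A s : in_Spin7 Phi E A -> is_form s ->
  proj7 (pullback A s) = pullback A (proj7 s).
Proof.
move=> spinA form_s.
have p7E t : is_form t -> 16%:R *: proj7 t =
    2%:R *: (t + star t) - 28%:R *: proj1 t - Lambda Phi E t.
  by move=> form_t; rewrite Lambda_proj // subKr.
apply: (scalerI (a := 16%:R)); first by rewrite pnatr_eq0.
rewrite -pullbackZ !p7E //; last exact: form_pullback.
rewrite proj1_spin7 // (hodge_spin7 uE spinA) (Lambda_spin7 uE spinA).
by move: (proj1 s) => p; rewrite !(pullbackD, pullbackN) !pullbackZ pullbackD.
Qed.

Lemma proj27_spin7 A s : in_Spin7 Phi E A -> is_form s ->
  proj27 (pullback A s) = pullback A (proj27 s).
Proof.
move=> spinA form_s; rewrite !proj27E !(pullbackD, pullbackN).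
by rewrite proj1_spin7 // proj7_spin7 // proj35_spin7.
Qed.

(* By irreducibility the kernel of an equivariant map on [W]
   is trivial or everything, and the target is too small for it to be trivial. *)
Lemma irreducible_vanish W U (f : {linear tensor R 4 -> tensor R 4}) :
    spin7_irreducible Phi E W -> (\dim U < \dim W)%N ->
    (forall s, s \in W -> f s \in U) ->
    (forall A s, in_Spin7 Phi E A -> s \in W -> f (pullback A s) = pullback A (f s)) ->
  forall s, s \in W -> f s = 0.
Proof.
have FE s : linfun f s = f s by rewrite lfunE.
case=> _ invW irrW lt_UW fU equiv.
case: (irrW (W :&: lker (linfun f))%VS (capvSl _ _)).
- move=> A spinA s; rewrite !memv_cap !memv_ker !FE => /andP[sW /eqP fs0].
  by rewrite invW //= equiv // fs0 pullback0.
- move=> /limg_dim_eq dimF; move: lt_UW; rewrite -dimF ltnNge dimvS //.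
  by apply/subvP => _ /memv_imgP[s sW ->]; rewrite FE fU.
- by move=> eqW s; rewrite -{1}eqW memv_cap memv_ker FE => /andP[_ /eqP].
Qed.

(** With positivity, a form orthogonal to its own projection has projection 0; this and the next two
    lemmas convert orthogonality of summands into vanishing of projections. *)
Lemma inner_proj35 s : is_form s -> dotp s (proj35 s) = dotp (proj35 s) (proj35 s).
Proof.
move=> form_s; have form35 := form_proj35 E form_s; have star35 := hodge_proj35 uE form_s.
rewrite (innerC uE) [X in dotp _ X = _](proj_sum E) !innerD !(innerC uE (proj35 s)).
have z t : is_form t -> star t = t -> dotp t (proj35 s) = 0.
  by move=> form_t star_t; exact: inner_selfdual_antiselfdual star35.
rewrite (z (proj1 s)); last first.
- by rewrite linearZ /= hodge_phi.
- by apply: is_formZ; exact: form_spin7.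
rewrite (z (proj7 s)); [|exact: form_sum_f7|exact: hodge_sum_f7].
by rewrite (z (proj27 s)) ?add0r //; [exact: form_proj27|exact: hodge_proj27].
Qed.

Lemma inner_proj27 s : is_form s -> dotp s (proj27 s) = dotp (proj27 s) (proj27 s).
Proof.
move=> form_s; have form27 := form_proj27 E form_s; have star27 := hodge_proj27 uE form_s.
rewrite (innerC uE) [X in dotp _ X = _](proj_sum E) !innerD innerZ.
rewrite (innerC uE _ Phi) inner_phi_proj27 // mulr0 add0r.
rewrite (inner_selfdual_antiselfdual uE _ _ star27 (hodge_proj35 uE form_s)) //; last first.
  exact: form_proj35.
rewrite addr0 inner_sum_f7 big1 ?add0r // => b _.
by rewrite (innerC uE _ (f7 b)) inner_f7_proj27 // mulr0.
Qed.

Lemma inner_proj7 s : is_form s -> dotp s (proj7 s) = dotp (proj7 s) (proj7 s).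
Proof.
move=> form_s; have form7 := form_sum_f7 E (fun b => 128%:R^-1 * dotp (f7 b) s).
rewrite (innerC uE) [X in dotp _ X = _](proj_sum E) !innerD innerZ.
rewrite (innerC uE _ Phi) inner_phi_sum // mulr0 add0r.
rewrite (inner_selfdual_antiselfdual uE _ _ _ (hodge_proj35 uE form_s)) //; last first.
- exact: hodge_sum_f7.
- exact: form_proj35.
suff -> : dotp (proj7 s) (proj27 s) = 0 by rewrite !addr0.
rewrite (innerC uE) inner_sum_f7 big1 // => b _.
by rewrite (innerC uE _ (f7 b)) inner_f7_proj27 // mulr0.
Qed.

Variables O1 O7 O27 O35 : {vspace tensor R 4}.
Hypothesis dec : spin7_decomposition Phi E O1 O7 O27 O35.
Notation V := (O1 + O7 + O27 + O35)%VS.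

Let formV s : s \in V -> is_form s. Proof. by move/(decomp_sum dec). Qed.
Let sub1 : (O1 <= V)%VS.
Proof. by rewrite -!addvA addvSl. Qed.
Let sub7 : (O7 <= V)%VS.
Proof. by rewrite -!addvA (subv_trans _ (addvSr _ _)) ?addvSl. Qed.
Let sub27 : (O27 <= V)%VS.
Proof. by rewrite -addvA (subv_trans _ (addvSr _ _)) ?addvSl. Qed.
Let sub35 : (O35 <= V)%VS.
Proof. exact: addvSr. Qed.

Let form1 s : s \in O1 -> is_form s. Proof. by move/(subvP sub1)/formV. Qed.
Let form7 s : s \in O7 -> is_form s. Proof. by move/(subvP sub7)/formV. Qed.
Let form27 s : s \in O27 -> is_form s. Proof. by move/(subvP sub27)/formV. Qed.
Let form35 s : s \in O35 -> is_form s. Proof. by move/(subvP sub35)/formV. Qed.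

Definition span7 := <<[tuple f7 b | b < 7]>>%VS.

Lemma mem_span7 (c : 'I_7 -> R) : \sum_b c b *: f7 b \in span7.
Proof.
apply: memv_suml => b _; apply: memvZ; apply: memv_span.
by apply/tnthP; exists b; rewrite tnth_mktuple.
Qed.

Lemma span7P s : s \in span7 -> exists c, s = \sum_b c b *: f7 b.
Proof.
move=> /coord_span ->; exists (fun b => coord [tuple f7 b | b < 7] b s).
by apply: eq_bigr => b _; rewrite nth_mktuple.
Qed.

Lemma dim_span7 : (\dim span7 <= 7)%N.
Proof. by rewrite (leq_trans (dim_span _)) // size_tuple. Qed.

Lemma proj1_vanish W : spin7_irreducible Phi E W -> (1 < \dim W)%N ->
  forall s, s \in W -> proj1 s = 0.
Proof.
move=> irrW dimW; apply: (@irreducible_vanish W <[Phi]>%VS proj1) => //.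
- by rewrite dim_vline (leq_ltn_trans (leq_b1 _)).
- by move=> s _; rewrite memvZ // memv_line.
- by move=> A s spinA _; exact: proj1_spin7.
Qed.

Lemma proj7_vanish W : spin7_irreducible Phi E W -> (7 < \dim W)%N ->
    (forall s, s \in W -> is_form s) ->
  forall s, s \in W -> proj7 s = 0.
Proof.
move=> irrW dimW formW; apply: (@irreducible_vanish W span7 proj7) => //.
- by rewrite (leq_ltn_trans dim_span7).
- by move=> s _; exact: mem_span7.
- by move=> A s spinA sW; apply: proj7_spin7 => //; exact: formW.
Qed.

Let W27 := (proj27 @: V)%VS.

Let W27P s : s \in W27 -> [/\ is_form s, star s = s, dotp Phi s = 0 &
  forall b, dotp (f7 b) s = 0].
Proof.
case/memv_imgP => t /formV form_t ->; split.
- exact: form_proj27.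
- exact: hodge_proj27.
- exact: inner_phi_proj27.
- by move=> b; exact: inner_f7_proj27.
Qed.

Let W35 := (linfun proj35 @: V)%VS.

Let W35P s : s \in W35 -> is_form s /\ star s = - s.
Proof.
case/memv_imgP => t /formV form_t ->; rewrite lfunE /=.
by split; [exact: form_proj35|exact: hodge_proj35].
Qed.

Lemma proj35_antiselfdual s : star s = - s -> proj35 s = s.
Proof.
by rewrite /proj_35 => ->; rewrite opprK -mulr2n -scaler_nat scalerA mulVf ?scale1r ?pnatr_eq0.
Qed.

Lemma proj35_selfdual s : star s = s -> proj35 s = 0.
Proof. by rewrite /proj_35 => ->; rewrite subrr scaler0. Qed.

(** Since 35 exceeds 27, 7 and 1, irreducibility kills the other three projections on [O35]. This
    puts it inside the space [W35] of anti-self-dual forms, whose dimension is at most 35. *)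
Lemma O35P s : s \in O35 <-> is_form s /\ star s = - s.
Proof.
have [_ _ _ irr35] := decomp_irreducible dec; have [_ _ _ dim35] := decomp_dim dec.
have p27 : forall s, s \in O35 -> proj27 s = 0.
  apply: (@irreducible_vanish O35 W27 proj27) => //.
  - by rewrite dim35 ltnS (leq_trans (dim_orthogonal_selfdual uE W27P)).
  - by move=> t tO; rewrite memv_img // (subvP sub35).
  - by move=> A t spinA tO; apply: proj27_spin7 => //; exact: form35.
have subW : (O35 <= W35)%VS.
  apply/subvP => t tO; rewrite (proj_sum E t) p27 // (proj7_vanish irr35) ?dim35 //.
  rewrite (proj1_vanish irr35) ?dim35 // !add0r -[proj35 t]lfunE memv_img //.
  exact: (subvP sub35).
have /eqP eqW : O35 == W35.
  rewrite eqEdim subW dim35 (@dim_hodge_eigen _ _ uE _ (-1)) ?oppr_eq0 ?oner_neq0 //.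
  by move=> t /W35P[form_t ->]; rewrite scaleN1r.
split=> [|[form_s star_s]]; first by rewrite eqW => /W35P.
rewrite eqW -[s](proj35_antiselfdual star_s) -[proj35 s]lfunE memv_img //.
exact/(decomp_sum dec).
Qed.

Lemma proj35_orthogonal W : (forall s, s \in W -> is_form s) ->
  orthogonal4 E W O35 -> forall s, s \in W -> proj35 s = 0.
Proof.
move=> formW orthW s sW; have form_s := formW _ sW; apply: (inner_eq0 uE).
rewrite -inner_proj35 //; apply: orthW => //; apply/O35P.
by split; [exact: form_proj35|exact: hodge_proj35].
Qed.

(** Dimension excludes only the targets of dimension 7 and 1; the anti-self-dual part is excluded by
    orthogonality to [O35], now known to contain all anti-self-dual forms. *)
Lemma O27P s : s \in O27 <-> [/\ is_form s, star s = s, dotp Phi s = 0 &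
  forall b, dotp (f7 b) s = 0].
Proof.
have [_ _ irr27 _] := decomp_irreducible dec; have [_ _ dim27 _] := decomp_dim dec.
have [_ _ orth] := decomp_orthogonal2 dec.
have subW : (O27 <= W27)%VS.
  apply/subvP => t tO; rewrite (proj_sum E t) (proj35_orthogonal form27) //.
  rewrite (proj7_vanish irr27) ?dim27 // (proj1_vanish irr27) ?dim27 //.
  by rewrite !add0r addr0 memv_img // (subvP sub27).
have /eqP eqW : O27 == W27 by rewrite eqEdim subW dim27 (dim_orthogonal_selfdual uE W27P).
split=> [|[form_s star_s phi_s f7_s]]; first by rewrite eqW => /W27P.
rewrite eqW (proj_sum E s) proj1_eq0 // proj7_eq0 // proj35_selfdual // !add0r addr0.
by rewrite memv_img //; exact/(decomp_sum dec).
Qed.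

Lemma proj27_orthogonal W : (forall s, s \in W -> is_form s) ->
  orthogonal4 E W O27 -> forall s, s \in W -> proj27 s = 0.
Proof.
move=> formW orthW s sW; have form_s := formW _ sW; apply: (inner_eq0 uE).
rewrite -inner_proj27 //; apply: orthW => //; apply/O27P; split.
- exact: form_proj27.
- exact: hodge_proj27.
- exact: inner_phi_proj27.
- by move=> b; exact: inner_f7_proj27.
Qed.

Lemma O7P s : s \in O7 <-> exists c, s = \sum_b c b *: f7 b.
Proof.
have [_ irr7 _ _] := decomp_irreducible dec; have [_ dim7 _ _] := decomp_dim dec.
have [orth27 orth35 _] := decomp_orthogonal2 dec.
have subW : (O7 <= span7)%VS.
  apply/subvP => t tO; rewrite (proj_sum E t) (proj35_orthogonal form7) //.
  rewrite (proj27_orthogonal form7) // (proj1_vanish irr7) ?dim7 //.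
  by rewrite add0r !addr0; exact: mem_span7.
have /eqP eqW : O7 == span7 by rewrite eqEdim subW dim7 dim_span7.
by split=> [|[c ->]]; rewrite eqW; [exact: span7P|exact: mem_span7].
Qed.

(** In dimension 1 no target is smaller, so all three other projections are killed by
    orthogonality. *)
Lemma O1P s : s \in O1 <-> exists c, s = c *: Phi.
Proof.
have [dim1 _ _ _] := decomp_dim dec.
have [orth7 orth27 orth35] := decomp_orthogonal1 dec.
have subW : (O1 <= <[Phi]>)%VS.
  apply/subvP => t tO; have form_t := form1 tO.
  have p7 : proj7 t = 0.
    apply: (inner_eq0 uE); rewrite -inner_proj7 //; apply: orth7 => //.
    by apply/O7P; eexists.
  rewrite (proj_sum E t) (proj35_orthogonal form1) // (proj27_orthogonal form1) //.
  by rewrite p7 !addr0 memvZ // memv_line.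
have /eqP eqW : O1 == <[Phi]>%VS.
  by rewrite eqEdim subW dim1 dim_vline leq_b1.
split=> [|[c ->]]; rewrite eqW; last by rewrite memvZ // memv_line.
by case/vlineP => c ->; exists c.
Qed.

End Irreducibles.

Theorem proposition2p8 (R : realType) (Phi : tensor R 4) (E : 'M[R]_8)
    (O1 O7 O27 O35 : {vspace tensor R 4}) :
  spin7_coframe Phi E ->
  spin7_decomposition Phi E O1 O7 O27 O35 ->
  [/\ (forall s, s \in O1 <-> is_form s /\ Lambda Phi E s = - 24%:R *: s),
      (forall s, s \in O27 <-> is_form s /\ Lambda Phi E s = 4%:R *: s),
      (forall s, s \in O7 <-> is_form s /\ Lambda Phi E s = - 12%:R *: s)
    & (forall s, s \in O35 <-> is_form s /\ Lambda Phi E s = 0)]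
  /\
  [/\ (forall s, s \in O1 <-> exists c : R, s = Dop Phi E (c *: metric E)),
      (forall s, s \in O7 <->
         exists A : 'M[R]_8, Omega2_7 Phi E (tensor_of_mx A) /\ s = Dop Phi E A)
    & (forall s, s \in O35 <->
         exists A : 'M[R]_8, sym_traceless E A /\ s = Dop Phi E A)]
  /\
  [/\ directv (O1 + O7 + O27)%VS,
      (forall s, is_form s /\ hodge4 E s = s <-> s \in (O1 + O7 + O27)%VS)
    & (forall s, is_form s /\ hodge4 E s = - s <-> s \in O35)].
Proof.
move=> [uE ->] dec; have form_Phi := form_spin7 E.
have O1E := O1P uE dec; have O7E := O7P uE dec.
have O27E := O27P uE dec; have O35E := O35P uE dec.
split; last split; split.
- by move=> s; rewrite O1E eigenspace1.
- by move=> s; rewrite O27E eigenspace27.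
- by move=> s; rewrite O7E eigenspace7.
- by move=> s; rewrite O35E eigenspace35.
(* D(c g) = 4 c Phi, hence the factors 4 and 1/4. *)
- move=> s; rewrite O1E; split=> -[c ->]; last by exists (4%:R * c); rewrite Dop_metric.
  by exists (4%:R^-1 * c); rewrite Dop_metric // mulrA mulfV ?mul1r ?pnatr_eq0.
- move=> s; rewrite O7E; split=> [[c ->]|[A [/(Omega2_7P uE)[/form2_antisym antiA _] ->]]].
    exact: span_f7_Dop.
  exact: Dop_antisym.
- move=> s; rewrite O35E; split=> [[form_s]|[A [symA ->]]].
    exact: antiselfdual_Dop.
  by split; [exact: form_Dop|exact: Dop_sym_antiselfdual].
- by have := decomp_direct dec; rewrite directv_addE => /and3P[].
- move=> s; split=> [[form_s star_s]|].
    (* A self-dual form has no anti-self-dual part, and its other three projections lie in the three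
       summands. *)
    rewrite (proj_sum E s) proj35_selfdual // addr0; apply: memv_add; first apply: memv_add.
    + by apply/O1E; eexists.
    + by apply/O7E; eexists.
    + apply/O27E; split; [exact: form_proj27|exact: hodge_proj27|exact: inner_phi_proj27|].
      by move=> b; exact: inner_f7_proj27.
  case/memv_addP => _ /memv_addP[_ /O1E[c ->] [_ /O7E[d ->] ->]].
  case=> t /O27E[form_t star_t _ _] ->; split.
    apply: is_formD => //; apply: is_formD; first exact: is_formZ.
    exact: form_sum_f7.
  by rewrite !linearD /= linearZ /= hodge_phi // hodge_sum_f7 // star_t.
- by move=> s; rewrite O35E.
Qed.
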